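(* Let $G$ be a loopless $2$-connected plane graph. A graph $H$ is a $2$-connected induced subgraph of $G$ if and only if $H^*$ is a $2$-connected cc-minor of $G^*$.
   Context: Graphs are finite and may have loops and parallel edges. A graph $G$ is $2$-connected if $|V(G)|\ge 2$ and any two distinct vertices $u,v$ are joined by at least two pairwise internally disjoint $uv$-paths. For a plane graph $G$, $G^*$ denotes its planar dual, whose edges are identified with the edges of $G$. A subgraph of the plane graph $G$ carries the embedding inherited from $G$, and a graph obtained from the plane graph $G^*$ by contractions carries the embedding inherited from $G^*$; $H$ and $H^*$ are dual plane graphs with respect to these embeddings. A cycle may have one edge (a loop) or two edges (a pair of parallel edges). For a cycle $C$ of $J$, $J/C$ is the graph obtained by contracting all edges of $C$; contracting a loop means deleting it. A graph $K$ is a cc-minor of $J$ if there is a sequence $J_0,J_1,\dots,J_n$ of graphs ($n\ge 0$) with $(J_0,J_n)=(J,K)$ such that, for each $i\in\{1,\dots,n\}$, there is a cycle $C_{i-1}$ of $J_{i-1}$ with $J_i=J_{i-1}/C_{i-1}$. Every cycle contraction is accompanied by the contraction (that is, deletion) of all loops it creates. *)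

(* Defs.v *)
From mathcomp Require Import all_boot all_fingroup.

Set Implicit Arguments.
Unset Strict Implicit.
Unset Printing Implicit Defensive.

(* x is sent to the first element of A met along p x, p (p x), ...; elements
   outside A are fixed. *)
Section FirstReturn.
Variables (T : finType) (p : {perm T}) (A : {set T}).

Definition first_return_fun (x : T) : T :=
  next [seq y <- fingraph.orbit p x | y \in A] x.

Lemma first_return_subproof : injective first_return_fun.
Proof.
pose s x := [seq y <- fingraph.orbit p x | y \in A].
have us x : uniq (s x) by rewrite filter_uniq ?orbit_uniq.
apply: (can_inj (g := fun x => prev (s x) x)) => x.
have [xs|xs] := boolP (x \in s x); last first.
  have fx : first_return_fun x = x.
    by rewrite /first_return_fun next_nth (negPf xs).
  by rewrite fx prev_nth (negPf xs).
rewrite /first_return_fun -/(s x).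
have : next (s x) x \in s x by rewrite mem_next.
rewrite {1}/s mem_filter => /andP[_ yo].
have [i sy] := orbit_rot_cycle (cycle_orbit (@perm_inj _ p) x)
  (orbit_uniq p x) yo.
rewrite {1}/s sy /seq.rot filter_cat.
have sE : s x = [seq y <- take i (fingraph.orbit p x) | y \in A] ++
                [seq y <- drop i (fingraph.orbit p x) | y \in A].
  by rewrite -filter_cat cat_take_drop.
by rewrite -rot_size_cat -sE prev_rot ?prev_next.
Qed.

Definition first_return : {perm T} := perm first_return_subproof.

End FirstReturn.

Lemma first_return_on (T : finType) (p : {perm T}) (A : {set T}) :
  perm_on A (first_return p A).
Proof.
apply/subsetP => x; rewrite inE permE; apply: contraR => xA.
by rewrite /first_return_fun next_nth mem_filter (negPf xA).
Qed.

(* Plane graphs are represented by combinatorial maps.  Each edge e has two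
   darts (e, false) and (e, true), its two directions.  The permutation sigma
   sends a dart to the next one counterclockwise around the vertex it leaves,
   so that the vertices are the cycles of sigma.  Loops and parallel edges are
   allowed.  Isolated vertices are not represented, and the map without edges
   stands for the one-vertex graph: a 2-connected graph has no isolated vertex,
   and a contraction of a connected graph has one only if it is that one-vertex
   graph.  Maps over the same E have a common supply of labelled edges, which
   is how the edges of a graph, its dual, subgraphs and contractions are
   identified. *)

Definition dart (E : finType) : finType := (E * bool)%type.

Section Maps.
Variable E : finType.

Definition rev_dart (d : dart E) : dart E := (d.1, ~~ d.2).

Lemma rev_dartK : involutive rev_dart.
Proof. by case=> e b; rewrite /rev_dart /= negbK. Qed.

Definition rev_perm : {perm dart E} := perm (can_inj rev_dartK).

Definition darts_of (A : {set E}) : {set dart E} := [set d | d.1 \in A].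

Record rmap := RMap {
  edges : {set E};
  sigma : {perm dart E};
  sigma_on : perm_on (darts_of edges) sigma
}.

Implicit Types (J K L G H : rmap) (d : dart E) (e : E) (A S : {set E}).

Definition darts J : {set dart E} := darts_of (edges J).

Definition src J d : {set dart E} := porbit (sigma J) d.
Definition tgt J d : {set dart E} := src J (rev_dart d).

Definition vertices J : {set {set dart E}} := [set src J d | d in darts J].

(* The map with edge set A whose rotation is the one induced by p. *)
Definition induced_map A (p : {perm dart E}) : rmap :=
  RMap (first_return_on p (darts_of A)).

(* face_perm J d is the dart that follows d along the boundary of the face on
   the left of d. *)
Definition face_perm J : {perm dart E} := (rev_perm * (sigma J)^-1)%g.

Definition faces J : {set {set dart E}} :=
  [set porbit (face_perm J) d | d in darts J].

Definition adjacent_darts J : rel (dart E) :=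
  [rel d d' | (d' == sigma J d) || (d' == rev_dart d)].

Definition components J : {set {set dart E}} :=
  [set [set d' | connect (adjacent_darts J) d d'] | d in darts J].

(* Euler's formula, i.e. every component has genus 0. *)
Definition plane J : Prop :=
  #|vertices J| + #|faces J| = #|edges J| + 2 * #|components J|.

(* The dart d of the dual leaves the face on the left of d and crosses d to the
   face on its right. *)
Definition dual J : rmap := induced_map (edges J) (face_perm J).

Definition is_loop J e : bool := src J (e, false) == src J (e, true).

Definition loopless J : Prop := {in edges J, forall e, ~~ is_loop J e}.

(* Walks, paths and cycles are given by the sequence of their darts. *)
Fixpoint walk J (u : {set dart E}) (w : seq (dart E)) (v : {set dart E}) : bool :=
  if w is d :: w' then [&& d \in darts J, src J d == u & walk J (tgt J d) w' v]
  else u == v.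

Definition is_path J u (w : seq (dart E)) v : bool :=
  walk J u w v && uniq (u :: map (tgt J) w).

Definition inner_vertices J (w : seq (dart E)) : seq {set dart E} :=
  behead (map (src J) w).

Definition internally_disjoint J (w w' : seq (dart E)) : bool :=
  ~~ has (mem (inner_vertices J w)) (inner_vertices J w').

Definition two_connected J : Prop :=
  1 < #|vertices J| /\
  {in vertices J &, forall u v, u != v ->
    exists w w', [/\ w != w', is_path J u w v, is_path J u w' v
                   & internally_disjoint J w w']}.

Definition is_cycle J (c : seq (dart E)) : Prop :=
  [/\ c != [::], exists u, walk J u c u, uniq (map (src J) c)
    & uniq [seq d.1 | d <- c]].

(* The subgraph of G induced by the vertices in X. *)
Definition induced_sub G (X : {set {set dart E}}) : rmap :=
  induced_map [set e in edges G | (src G (e, false) \in X)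
                                  && (src G (e, true) \in X)] (sigma G).

Definition induced_subgraph H G : Prop :=
  exists2 X : {set {set dart E}}, X \subset vertices G & H = induced_sub G X.

Definition delete J S : rmap := induced_map (edges J :\: S) (sigma J).

(* If e is not a loop, its ends, with rotations (d a1 ... ak) and
   (rev_dart d b1 ... bl), merge into a vertex with rotation
   (a1 ... ak b1 ... bl). *)
Definition contract J e : rmap :=
  if is_loop J e then delete J [set e]
  else induced_map (edges J :\ e) (sigma J * tperm (e, false) (e, true))%g.

Definition contract_cycle J (c : seq (dart E)) : rmap :=
  foldl contract J [seq d.1 | d <- c].

Definition created_loops J K : {set E} :=
  [set e in edges K | is_loop K e && ~~ is_loop J e].

(* As a graph, J / C does not depend on the order in which the edges of C are
   contracted.  If J has edges on both sides of C, these two parts of J / C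
   share only the vertex obtained from C, and their relative position around it
   depends on which edge of C is contracted last; as c may start anywhere on C,
   every choice is allowed. *)
Definition cc_step J K : Prop :=
  exists2 c, is_cycle J c
    & K = delete (contract_cycle J c) (created_loops J (contract_cycle J c)).

Inductive cc_minor : rmap -> rmap -> Prop :=
| cc_minor_refl J : cc_minor J J
| cc_minor_step K L J : cc_minor K J -> cc_step K L -> cc_minor L J.

End Maps.

(* Main.v *)
Require Import Defs.
From mathcomp Require Import all_boot all_fingroup zify.

(** Contracting an edge of the dual of a plane map G that is not a loop deletes this
    edge in G, and deleting a loop of the dual contracts a bridge of G
    ([contract_dual]).  A cycle contraction of the dual, with the deletion of the
    loops it creates, thus deletes the edges of a bond of G except the last one,
    which has become a bridge, and then contracts this bridge and those dual to the
    created loops.  The proof relates cycles of the dual to cuts of G, where a cut is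
    given by a two-colouring of the vertices, that is, by a colouring of the darts
    that the rotation preserves.

    If H is a 2-connected induced subgraph with edge set F, each edge outside F is in
    a cut that avoids F.  The boundary of a face crosses a cut an even number of times,
    so such a cut contains a cycle of the dual, which avoids F
    ([dual_cycle_avoiding]).  Contracting it changes neither H, which lies on one side
    of each bridge, nor the property that edges outside F are in cuts avoiding F; so
    one can continue until only F is left ([cc_minor_restrict]).

    Conversely, each edge of a cycle of the dual is in a cut of G that is contained in
    the cycle, because an edge with the same face on both sides is a bridge
    ([cycle_cut]).  Hence each edge that is removed by a
    sequence of cycle contractions is in a cut of G that avoids the remaining edges
    ([cut_minor_step]).  If H remains and is 2-connected, then it was not glued together
    at a contracted bridge, so it is a subgraph of G ([unrestrict_reduce]); as it is
    connected, it lies on one side of each of these cuts, and no removed edge joins two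
    vertices of H.

    For this, 2-connectedness has to be transferred between a plane map and its dual.
    It is replaced by nonseparability: in every partition of the edges into two
    nonempty classes, at least two vertices meet both classes.  For maps with at least
    two edges this is equivalent to being loopless and 2-connected
    ([two_connected_nonseparable], and [nonseparable_two_connected] by Whitney's
    argument), and for plane maps it is self-dual ([dual_nonseparable]).

    Planarity enters through the Jordan curve theorem in the form [jordan]: where a
    vertex meets a face twice, the map falls apart.  It follows from Euler's
    inequality for pairs of permutations ([euler_inequality]), which is proved by
    splitting off transpositions. *)

Set Implicit Arguments.
Unset Strict Implicit.
Unset Printing Implicit Defensive.

(* Cardinals are generalized so that lia sees them as opaque numbers. *)
Ltac card_lia :=
  repeat match goal with H : context [card _] |- _ => move: H end;
  repeat match goal with |- context [@card ?T ?A] => move: (@card T A) => ? end; lia.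

(** * Permutations and Euler's formula *)

Section Perms.
Variable T : finType.
Implicit Types (p q h : {perm T}) (x y a b : T) (phi : T -> bool) (A B : {set T}).

(** With p a rotation, a colouring phi of the darts that p preserves is a
    colouring of the vertices. *)
Definition preserves p phi := forall x, phi (p x) = phi x.

Lemma porbit_step p x : porbit p (p x) = porbit p x.
Proof. by apply/eqP; rewrite eq_porbit_mem; have := mem_porbit p 1 x; rewrite expg1. Qed.

Lemma porbit_iter p n x : porbit p (iter n p x) = porbit p x.
Proof. by elim: n => //= n IHn; rewrite porbit_step. Qed.

Lemma same_porbit p x y : porbit p x = porbit p y -> exists n, y = iter n p x.
Proof.
move/esym/eqP; rewrite eq_porbit_mem => /porbitP[n ->].
by exists n; rewrite permX.
Qed.

Lemma preserves_porbit p phi x y :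
  preserves p phi -> porbit p x = porbit p y -> phi x = phi y.
Proof. by move=> pphi /same_porbit[n ->]; elim: n => //= n ->. Qed.

Lemma preservesV p phi : preserves p phi -> preserves p^-1 phi.
Proof. by move=> pphi x; rewrite -{2}[x](permKV p) pphi. Qed.

Lemma preserves_mem_porbit p x : preserves p [pred y | porbit p y == porbit p x].
Proof. by move=> y /=; rewrite porbit_step. Qed.

(** Going once around an orbit, a two-colouring changes as often in one direction
    as in the other. *)
Lemma opposite_change p phi x : phi (p x) != phi x ->
  exists y, [/\ porbit p y = porbit p x, phi y = phi (p x) & phi (p y) = phi x].
Proof.
move=> px; have [/existsP[y /and3P[/eqP ? /eqP ? /eqP ?]]|] := boolP
  [exists y, [&& porbit p y == porbit p x, phi y == phi (p x) & phi (p y) == phi x]].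
  by exists y.
move=> /existsPn nex.
have stay n : phi (iter n p (p x)) = phi (p x).
  elim: n => //= n IHn; have:= nex (iter n p (p x)).
  rewrite porbit_iter porbit_step eqxx IHn eqxx /=.
  by move: px; do 3 case: (phi _).
have [n xE] := same_porbit (porbit_step p x).
by rewrite [in phi x]xE stay eqxx in px.
Qed.

Definition step_rel p q : rel T := [rel x y | (y == p x) || (y == q x)].

(** The orbit of x under the group generated by p and q.  It is compared with
    other orbits only through the colourings that p and q preserve
    ([joint_orbitP]), which depend on the group alone. *)
Definition joint_orbit p q x := [set y | connect (step_rel p q) x y].
Definition joint_orbits p q := [set joint_orbit p q x | x : T].

Lemma connect_preserves p q phi x y : preserves p phi -> preserves q phi ->
  connect (step_rel p q) x y -> phi x = phi y.
Proof.
move=> pphi qphi /connectP[s].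
elim: s x => [|z s IHs] x /= => [_ ->//|/andP[xz /IHs{}IHs] /IHs <-].
by case/orP: xz => /eqP ->.
Qed.

(** The connection relation is directed, but the set reached from x is mapped
    into itself, hence onto itself, by a permutation of a finite set. *)
Lemma joint_orbit_preserves p q x :
  preserves p (mem (joint_orbit p q x)) /\ preserves q (mem (joint_orbit p q x)).
Proof.
suff H r : (r = p \/ r = q) -> preserves r (mem (joint_orbit p q x)).
  by split; apply: H; [left|right].
move=> rpq; set A := joint_orbit p q x.
have sub : r @: A \subset A.
  apply/subsetP => _ /imsetP[y yA ->]; move: yA; rewrite !inE => /connect_trans.
  by apply; apply: connect1; case: rpq => ->; rewrite /step_rel /= eqxx ?orbT.
have /eqP rA : r @: A == A by rewrite eqEcard sub card_imset //=; apply: perm_inj.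
by move=> y /=; rewrite -[in LHS]rA mem_imset //; apply: perm_inj.
Qed.

Lemma mem_joint_orbit p q x : x \in joint_orbit p q x.
Proof. by rewrite inE. Qed.

Lemma joint_orbitP p q x y : reflect
  (forall phi, preserves p phi -> preserves q phi -> phi x = phi y)
  (y \in joint_orbit p q x).
Proof.
rewrite inE; apply: (iffP idP) => [xy phi pphi qphi|H].
  exact: connect_preserves pphi qphi xy.
have [H1 H2] := joint_orbit_preserves p q x.
by have := H _ H1 H2; rewrite /= !inE connect0 => <-.
Qed.

Lemma joint_orbit_eqP p q x y :
  reflect (joint_orbit p q x = joint_orbit p q y) (y \in joint_orbit p q x).
Proof.
apply: (iffP idP) => [/joint_orbitP xy|->]; last exact: mem_joint_orbit.
apply/setP => z; apply/joint_orbitP/joint_orbitP => H phi Hp Hq.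
  by rewrite -(xy phi) // H.
by rewrite (xy phi) // H.
Qed.

Lemma eq_joint_orbit p q p' q' :
  (forall phi, preserves p phi -> preserves q phi ->
     preserves p' phi /\ preserves q' phi) ->
  (forall phi, preserves p' phi -> preserves q' phi ->
     preserves p phi /\ preserves q phi) ->
  joint_orbit p q =1 joint_orbit p' q'.
Proof.
move=> H1 H2 x; apply/setP => y; apply/joint_orbitP/joint_orbitP => H phi Hp Hq.
  by have [] := H2 _ Hp Hq; apply: H.
by have [] := H1 _ Hp Hq; apply: H.
Qed.

Lemma eq_joint_orbits p q p' q' :
  joint_orbit p q =1 joint_orbit p' q' -> joint_orbits p q = joint_orbits p' q'.
Proof. by move=> H; apply: eq_imset. Qed.

(** A colouring that takes the same value at a and b cannot see whether p is
    composed with their transposition. *)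
Lemma preserves_tperm p phi a b :
  phi a = phi b -> preserves (tperm a b * p) phi <-> preserves p phi.
Proof.
move=> ab; have tphi x : phi (tperm a b x) = phi x by case: tpermP => // ->.
split=> H x; last by rewrite permM H tphi.
by rewrite -{1}[x](tpermK a b) -permM H tphi.
Qed.

(** If a and b lie in one orbit of p, then tperm a b * p splits that orbit; no
    connection is lost as long as a and b remain connected. *)
Lemma joint_orbit_split p q a b : porbit p a = porbit p b ->
  b \in joint_orbit (tperm a b * p) q a -> joint_orbit (tperm a b * p) q =1 joint_orbit p q.
Proof.
move=> ab /joint_orbitP ab'; apply: eq_joint_orbit => phi Hp Hq; split=> //.
  by apply/(preserves_tperm _ (ab' phi Hp Hq)).
by apply/preserves_tperm => //; apply: preserves_porbit ab.
Qed.

(** Splitting an orbit of p at a and b breaks at most one joint orbit, into the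
    parts of a and of b. *)
Lemma card_joint_orbits_split p q a b : porbit p a = porbit p b ->
  #|joint_orbits (tperm a b * p) q| <= #|joint_orbits p q|.+1.
Proof.
move=> ab; set p' := (tperm a b * p)%g.
rewrite (cardsD1 (joint_orbit p' q b)) -[X in _ <= X]addn1 addnC leq_add ?leq_b1 //.
(* r sends a joint orbit of the split pair to the joint orbit containing it. *)
pose r (C : {set T}) := joint_orbit p q (odflt a [pick x in C]).
have rE x : joint_orbit p q x = joint_orbit p q (odflt a [pick y in joint_orbit p' q x]).
  case: pickP => [y /joint_orbitP xy|/(_ x)]; last by rewrite mem_joint_orbit.
  apply/joint_orbit_eqP/joint_orbitP => phi Hp Hq; apply: xy => //.
  by apply/preserves_tperm => //; apply: preserves_porbit ab.
have rinj : {in joint_orbits p' q :\ joint_orbit p' q b &, injective r}.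
  move=> C C'; rewrite !inE => /andP[xb /imsetP[x _ CE]] /andP[yb /imsetP[y _ C'E]].
  rewrite /r CE C'E -!rE; rewrite {C}CE {C'}C'E in xb yb * => xy.
  apply/eqP/negPn/negP => nxy.
  have key u v : joint_orbit p q u = joint_orbit p q v ->
      joint_orbit p' q u != joint_orbit p' q b ->
      joint_orbit p' q u != joint_orbit p' q v -> joint_orbit p' q u = joint_orbit p' q a.
    move=> /joint_orbit_eqP/joint_orbitP uv ub nuv; have [Hp Hq] := joint_orbit_preserves p' q u.
    have mE w : mem (joint_orbit p' q u) w = (joint_orbit p' q u == joint_orbit p' q w).
      by apply/(joint_orbit_eqP p' q u w)/eqP.
    apply/eqP; rewrite -mE; apply: contraT => ua.
    have /uv/(_ Hq) : preserves p (mem (joint_orbit p' q u)).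
      by apply/(preserves_tperm p (a := a) (b := b)) => //; rewrite (negPf ua) mE (negPf ub).
    by rewrite !mE eqxx (negPf nuv).
  have ya : joint_orbit p' q y = joint_orbit p' q a by apply: key (esym xy) yb _; rewrite eq_sym.
  by case/eqP: (nxy); rewrite ya; apply: key xy xb nxy.
rewrite -(card_in_imset rinj) subset_leq_card //.
apply/subsetP => C' /imsetP[C /setD1P[_ /imsetP[x _ ->]] ->].
by rewrite /r -rE imset_f.
Qed.

Lemma joint_orbit1 q x : joint_orbit 1 q x = porbit q x.
Proof.
apply/setP => y; rewrite -eq_porbit_mem; apply/joint_orbitP/eqP => [H|yx phi _ qphi].
  have p1 : preserves 1 [pred z | porbit q z == porbit q x] by move=> z; rewrite perm1.
  by have /= := H _ p1 (preserves_mem_porbit q x); rewrite eqxx => /esym/eqP.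
by apply/esym/(preserves_porbit qphi).
Qed.

Lemma card_porbits1 : #|porbits (1 : {perm T})| = #|T|.
Proof.
rewrite card_imset // => x y /eqP; rewrite eq_porbit_mem => /porbitP[n ->].
by rewrite expg1n perm1.
Qed.

Lemma porbits_split p a b : a != b -> porbit p a = porbit p b ->
  #|porbits (tperm a b * p)| = #|porbits p|.+1.
Proof.
move=> ab /eqP; rewrite eq_porbit_mem => pab.
by have /= := porbits_mul_tperm p a b; rewrite pab ab addn0 addn1.
Qed.

Lemma porbits_merge p a b : porbit p a != porbit p b ->
  #|porbits (tperm a b * p)|.+1 = #|porbits p|.
Proof.
rewrite eq_porbit_mem => pab; have ab : a != b.
  by apply: contraNneq pab => ->; exact: porbit_id.
by have /= := porbits_mul_tperm p a b; rewrite pab ab; lia.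
Qed.

Lemma porbit_tperm_merged p a b : porbit p a != porbit p b ->
  porbit (tperm a b * p) a = porbit (tperm a b * p) b.
Proof.
move=> pab; apply/eqP/negPn/negP => /porbits_merge.
by rewrite mulgA tperm2 mul1g; have := porbits_merge pab; lia.
Qed.

Lemma merged_preserves p a b phi : porbit p a != porbit p b ->
  preserves (tperm a b * p) phi -> phi a = phi b.
Proof. by move=> /porbit_tperm_merged pab Hphi; apply: preserves_porbit pab. Qed.

Definition euler_sum p q := #|porbits p| + #|porbits q| + #|porbits (p * q)|.

(** The difference of the two sides is twice the total genus of the components, so
    this says that the genus is nonnegative.  It holds with equality for p = 1.
    Any other p arises from a permutation with one more orbit by merging two
    orbits at a and b.  If a and b were already connected, then the left side does
    not increase, and the number of joint orbits stays the same; otherwise the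
    orbits of p * q through a and b are merged as well, and both sides drop
    by two. *)
Lemma euler_inequality p q : euler_sum p q <= #|T| + 2 * #|joint_orbits p q|.
Proof.
elim/(@ltn_ind) : (#|T| - #|porbits p|) {-2}p (erefl (#|T| - #|porbits p|)) => n IHn {}p nE.
have [p1|] := boolP [forall x, p x == x].
  have -> : p = 1%g by apply/permP => x; rewrite perm1; apply/eqP/(forallP p1).
  rewrite /euler_sum mul1g card_porbits1 (_ : joint_orbits 1 q = porbits q) //; first lia.
  by apply: eq_imset => x; rewrite joint_orbit1.
case/forallPn => x px; set a := x; set b := p x.
have ab : a != b by rewrite eq_sym.
have pab : porbit p a = porbit p b by rewrite porbit_step.
(* p' skips b, which becomes a fixed point. *)
set p' := (tperm a b * p)%g.
have Ep' : #|porbits p'| = #|porbits p|.+1 by apply: porbits_split.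
have : #|porbits p'| <= #|T| by apply: leq_trans (leq_imset_card _ _) (max_card _).
move=> le; have := IHn _ _ p' erefl; rewrite -{1}nE => /(_ ltac:(lia)).
have := card_joint_orbits_split q pab; rewrite -/p' /euler_sum Ep'.
have pq : (tperm a b * (p * q) = p' * q)%g by rewrite mulgA.
have [e|ne] := eqVneq (porbit (p * q) a) (porbit (p * q) b).
  by have := porbits_split ab e; rewrite pq; lia.
have := porbits_merge ne; rewrite pq => Epq.
have : joint_orbit p' q =1 joint_orbit p q.
  apply: joint_orbit_split => //; apply/joint_orbitP => phi Hp Hq.
  apply: (merged_preserves ne); rewrite pq => y.
  by rewrite permM Hq Hp.
move/eq_joint_orbits => ->; lia.
Qed.

(** Euler's formula: all components have genus zero.  For a rotation p and the
    edge involution q, the orbits of p, q and p * q are the vertices, edges and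
    faces. *)
Definition spherical p q := euler_sum p q = #|T| + 2 * #|joint_orbits p q|.

(** A combinatorial Jordan curve theorem.  If a vertex meets a face at two
    corners a and b, cutting the vertex at these corners creates a vertex and a
    face; by the Euler inequality this is possible only if it disconnects a
    from b.  The colouring phi marks the part of a. *)
Lemma jordan p q a b : spherical p q -> a != b ->
  porbit p a = porbit p b -> porbit (p * q) a = porbit (p * q) b ->
  exists phi, [/\ preserves (tperm a b * p) phi, preserves q phi, phi a & ~~ phi b].
Proof.
move=> sph ab pab pqab; exists (mem (joint_orbit (tperm a b * p) q a)).
have [H1 H2] := joint_orbit_preserves (tperm a b * p) q a; split=> //=.
  exact: mem_joint_orbit.
apply/negP => /(joint_orbit_split pab)/eq_joint_orbits ncl.
have := euler_inequality (tperm a b * p) q; move: sph; rewrite /spherical /euler_sum.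
rewrite -mulgA ncl (porbits_split ab pab) (porbits_split ab pqab); card_lia.
Qed.

(** Splitting an orbit of p does not increase the genus.  In the case that loses
    an orbit of p * q, the points a and b remain connected, through the merged
    orbit. *)
Lemma spherical_split p q a b : spherical p q ->
  porbit p a = porbit p b -> spherical (tperm a b * p) q.
Proof.
have [->|ab] := eqVneq a b; first by rewrite tperm1 mul1g.
move=> sph pab; apply/eqP; rewrite eqn_leq euler_inequality /=; move: sph.
rewrite /spherical /euler_sum -mulgA (porbits_split ab pab).
have := card_joint_orbits_split q pab.
have [e|ne] := eqVneq (porbit (p * q) a) (porbit (p * q) b).
  by rewrite (porbits_split ab e); card_lia.
have := porbits_merge ne.
rewrite (eq_joint_orbits (joint_orbit_split (q := q) pab _)); first by card_lia.
apply/joint_orbitP => phi Hp Hq; apply: (merged_preserves ne) => y.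
by rewrite mulgA permM Hq Hp.
Qed.

(** Merging two vertices that lie on a common face, at corners of that face, splits
    the face and keeps the component. *)
Lemma spherical_merge p q a b : spherical p q -> porbit p a != porbit p b ->
  porbit (p * q) a = porbit (p * q) b -> spherical (tperm a b * p) q.
Proof.
move=> + pab pqab; have ab : a != b by apply: contraNneq pab => ->.
have pE : p = (tperm a b * (tperm a b * p))%g by rewrite mulgA tperm2 mul1g.
have : joint_orbit (tperm a b * (tperm a b * p)) q =1 joint_orbit (tperm a b * p) q.
  apply: joint_orbit_split; first exact: porbit_tperm_merged.
  rewrite -pE; apply/joint_orbitP => phi Hp Hq; apply: preserves_porbit pqab => y.
  by rewrite permM Hq Hp.
rewrite -pE => /eq_joint_orbits; rewrite /spherical /euler_sum => ->.
by have := porbits_merge pab; rewrite -mulgA (porbits_split ab pqab); card_lia.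
Qed.

Lemma imset_porbit p h x : h @: porbit p x = porbit (p ^ h) (h x).
Proof.
apply/setP => y; apply/imsetP/porbitP => [[z /porbitP[n ->] ->]|[n ->]].
  by exists n; rewrite -conjXg !permM permK.
by exists ((p ^+ n)%g x); rewrite ?mem_porbit // -conjXg !permM permK.
Qed.

Lemma card_porbits_conj p h : #|porbits (p ^ h)| = #|porbits p|.
Proof.
rewrite -(card_imset (porbits p) (imset_inj (@perm_inj _ h))).
congr #|pred_of_set _|; apply/setP => C.
apply/imsetP/imsetP => [[x _ ->]|[D /imsetP[x _ ->] ->]].
  by exists (porbit p (h^-1 x)%g); rewrite ?imset_f // imset_porbit permKV.
by exists (h x); rewrite ?imset_porbit.
Qed.

Lemma spherical_inv p q : spherical p q -> spherical q^-1 p^-1.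
Proof.
rewrite /spherical /euler_sum -invMg !porbitsV [#|porbits q| + _]addnC => ->.
rewrite (@eq_joint_orbits p q q^-1 p^-1) //; apply: eq_joint_orbit => phi Hp Hq.
  by split; apply: preservesV.
by rewrite -[p]invgK -[q]invgK; split; apply: preservesV.
Qed.

Lemma spherical_dual p q : (q * q = 1)%g -> spherical p q -> spherical (q * p^-1) q.
Proof.
move=> qq; have qV : q^-1%g = q by apply/eqP; rewrite eq_invg_mul qq.
rewrite /spherical /euler_sum.
have -> : (q * p^-1 * q = p^-1 ^ q)%g by rewrite conjgE qV mulgA.
have -> : (q * p^-1 = (p * q)^-1)%g by rewrite invMg qV.
rewrite card_porbits_conj !porbitsV => sph; transitivity (euler_sum p q).
  by rewrite /euler_sum; card_lia.
rewrite {1}/euler_sum sph.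
rewrite (@eq_joint_orbits p q (p * q)^-1 q) //; apply: eq_joint_orbit => phi Hp Hq; split=> //.
  by apply: preservesV => x; rewrite permM Hq Hp.
by move=> x; have := preservesV Hp x; rewrite invgK permM Hq.
Qed.

End Perms.

(** * First returns *)

Section FirstReturn.
Variable T : finType.
Implicit Types (p q : {perm T}) (x y : T) (phi : T -> bool) (A B : {set T}).

Lemma first_return_out p A x : x \notin A -> first_return p A x = x.
Proof. by move=> xA; apply: (out_perm (first_return_on p A)). Qed.

Lemma first_returnP p A x : x \in A -> exists k,
  [/\ first_return p A x = iter k.+1 p x, first_return p A x \in A
    & forall j, j < k -> iter j.+1 p x \notin A].
Proof.
move=> xA; rewrite permE /first_return_fun /fingraph.orbit -orderSpred /= xA.
have: iter (fingraph.order p x).-1 p (p x) = x.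
  by rewrite -iterSr orderSpred iter_order //; apply: perm_inj.
have nextE s : next (x :: s) x = head x s by case: s => [|y s] /=; rewrite eqxx.
have iterE j : iter j.+1 p x = iter j p (p x) by rewrite iterSr.
(* Generalize over the point from which the traject of p starts. *)
rewrite nextE => iterx; suff [k [-> kA kmin]] : exists k,
    [/\ head x [seq y <- traject p (p x) (fingraph.order p x).-1 | y \in A]
        = iter k p (p x), iter k p (p x) \in A
      & forall j, j < k -> iter j p (p x) \notin A].
  by exists k; rewrite -iterS iterE; split=> // j /kmin; rewrite -iterE.
move: iterx; elim: _.-1 (p x) => [|n IHn] z /= zx.
  by exists 0; split=> //; rewrite /= zx.
have [zA|zA] := boolP (z \in A); first by exists 0.
have [|k [-> kA kmin]] := IHn (p z); first by rewrite -iterSr.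
by exists k.+1; rewrite iterSr; split=> // -[|j] jk //; rewrite iterSr; apply: kmin.
Qed.

Lemma first_return_unique p A x k : x \in A -> iter k.+1 p x \in A ->
  (forall j, j < k -> iter j.+1 p x \notin A) -> first_return p A x = iter k.+1 p x.
Proof.
move=> xA kA kmin; have [l [-> lA lmin]] := first_returnP p xA.
case: (ltngtP k l) => [/lmin|/kmin|->//]; last by rewrite lA.
by rewrite kA.
Qed.

Lemma mem_first_return p A x : (first_return p A x \in A) = (x \in A).
Proof.
have [xA|xA] := boolP (x \in A); last by rewrite first_return_out // (negPf xA).
by have [k []] := first_returnP p xA.
Qed.

Lemma porbit_first_return_step p A x : porbit p (first_return p A x) = porbit p x.
Proof.
have [xA|xA] := boolP (x \in A); last by rewrite first_return_out.
by have [k [-> _ _]] := first_returnP p xA; rewrite porbit_iter.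
Qed.

Lemma first_return_preserves p A phi :
  preserves p phi -> preserves (first_return p A) phi.
Proof. by move=> H x; apply: (preserves_porbit H); apply: porbit_first_return_step. Qed.

Lemma porbit_first_return p A x y : x \in A -> y \in A ->
  porbit (first_return p A) x = porbit (first_return p A) y <->
  porbit p x = porbit p y.
Proof.
move=> xA yA; split=> [/same_porbit[n ->]|/same_porbit[n yE]].
  by elim: n => //= n ->; rewrite porbit_first_return_step.
elim/ltn_ind: n x xA yE => -[|n] IHn x xA yE; first by rewrite yE.
have [k [fE fA kmin]] := first_returnP p xA.
rewrite -(porbit_step _ x); have lt : n - k < n.+1 by lia.
apply: (IHn _ lt) => //.
have kn : k <= n by rewrite leqNgt; apply/negP => /kmin; rewrite -yE yA.
by rewrite yE fE -iterD; congr (iter _ p x); lia.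
Qed.

(** First returns compose: the first return to B among the first returns to A is
    the first return to the intersection. *)
Lemma first_returnI p A B :
  first_return (first_return p A) B = first_return p (A :&: B).
Proof.
apply/permP => x; have [xA|xA] := boolP (x \in A); last first.
  rewrite [RHS]first_return_out ?inE ?(negPf xA) //.
  have [xB|xB] := boolP (x \in B); last by rewrite first_return_out.
  by rewrite (@first_return_unique _ _ _ 0) //= first_return_out.
have [xB|xB] := boolP (x \in B); last first.
  by rewrite !first_return_out // inE (negPf xB) andbF.
have [k [-> kB kmin]] := first_returnP (first_return p A) xB.
have mixed_iter z n : z \in A -> iter n.+1 (first_return p A) z \in B ->
    (forall j, j < n -> iter j.+1 (first_return p A) z \notin B) ->
    exists l, [/\ iter n.+1 (first_return p A) z = iter l.+1 p z,
      iter l.+1 p z \in A :&: B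
    & forall j, j < l -> iter j.+1 p z \notin A :&: B].
  elim: n z => [|n IHn] z zA.
    have [l [zE lA lmin]] := first_returnP p zA => lB _.
    by exists l; rewrite -zE inE lA lB; split=> // j /lmin; rewrite inE => /negPf->.
  rewrite iterSr => nB nmin.
  have [l [zE lA lmin]] := first_returnP p zA.
  have [|m [mE mAB mmin]] := IHn (first_return p A z) lA nB.
    by move=> j jn; rewrite -iterSr; apply: nmin.
  have iterE j : iter j p (first_return p A z) = iter (l.+1 + j) p z.
    by rewrite zE -iterD addnC.
  rewrite iterE in mE mAB.
  exists (l.+1 + m); rewrite -addnS; split=> // j jlm.
  case: (ltngtP j l) => [/lmin|lj|->]; first by rewrite inE => /negPf->.
    have -> : j.+1 = l.+1 + (j - l) by lia.
    by rewrite -iterE -[j - l]prednK ?subn_gt0 //; apply: mmin; lia.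
  by rewrite -zE inE negb_and (nmin 0) ?orbT.
have [l [-> lAB lmin]] := mixed_iter _ _ xA kB kmin.
by rewrite (first_return_unique _ lAB) // inE xA.
Qed.

Lemma first_return_id p A : perm_on A p -> first_return p A = p.
Proof.
move=> pA; apply/permP => x; have [xA|xA] := boolP (x \in A).
  by rewrite (@first_return_unique _ _ _ 0) //=; rewrite (perm_closed _ pA).
by rewrite first_return_out // (out_perm pA).
Qed.

Lemma first_return_stable p A x : (forall y, (p y \in A) = (y \in A)) ->
  x \in A -> first_return p A x = p x.
Proof. by move=> pA xA; rewrite (@first_return_unique _ _ _ 0) //=; rewrite pA. Qed.

Lemma first_returnV p A : first_return p^-1 A = (first_return p A)^-1%g.
Proof.
apply/permP => x; apply: (@perm_inj _ (first_return p A)); rewrite permKV.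
have [xA|xA] := boolP (x \in A); last by rewrite !first_return_out.
have [k [-> kA kmin]] := first_returnP p^-1 xA.
have pK j n : j <= n -> iter j p (iter n p^-1%g x) = iter (n - j) p^-1%g x.
  elim: j => [|j IHj] jn; first by rewrite subn0.
  have nE : n - j = (n - j.+1).+1 by lia.
  by rewrite iterS IHj ?(ltnW jn) // nE /= permKV.
rewrite (@first_return_unique _ _ _ k) ?pK ?subnn //.
move=> j jk; rewrite pK; last exact: ltnW.
have -> : k.+1 - j.+1 = (k - j.+1).+1 by lia.
by apply: kmin; lia.
Qed.

(** Points of A in one orbit of p are in one orbit of the first return, so a
    colouring of the latter orbits is one of the former orbits that meet A; the
    remaining orbits get an arbitrary colour. *)
Lemma first_return_extend p A phi : preserves (first_return p A) phi ->
  exists2 psi, preserves p psi & {in A, psi =1 phi}.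
Proof.
move=> Hphi; pose psi x := if [pick y in A | porbit p y == porbit p x] is Some y
                           then phi y else false.
exists psi => [x|x xA]; rewrite /psi.
  by congr (if _ is Some y then phi y else false); apply: eq_pick => y; rewrite porbit_step.
case: pickP => [y /andP[yA /eqP yx]|/(_ x)]; last by rewrite xA eqxx.
by apply: (preserves_porbit Hphi); apply/porbit_first_return.
Qed.

(** Multiplying by the transposition of d and d' inserts the whole orbit of d into
    that of d'.  If A misses the orbit of d, a walk to the next element of A
    passes through the insertion without stopping. *)
Lemma first_return_mul_tperm p d d' A : porbit p d != porbit p d' ->
  {in A, forall x, porbit p x != porbit p d} ->
  first_return (p * tperm d d') A = first_return p A.
Proof.
move=> dd' Ad; pose B := [set x | porbit p x != porbit p d].
have -> : A = B :&: A.
  by apply/setP => x; rewrite !inE; have [/Ad ->|] := boolP (x \in A); rewrite ?andbF.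
rewrite -!first_returnI; congr (first_return _ A); apply/permP => x.
have [xB|xB] := boolP (x \in B); last by rewrite !first_return_out.
have pB y : (p y \in B) = (y \in B) by rewrite !inE porbit_step.
rewrite [RHS]first_return_stable //.
have dB : d \notin B by rewrite inE eqxx.
have d'B : d' \in B by rewrite inE eq_sym.
have pxd : p x != d by apply: contraNneq dB => <-; rewrite pB.
have [pxd'|pxd'] := eqVneq (p x) d'; last first.
  rewrite (@first_return_unique _ _ _ 0) //= permM tpermD // 1?eq_sym // pB //.
(* k.+1 is the length of the orbit of d. *)
have [k [kE _ kmin]] := first_returnP p (set11 d).
have iterE j : j <= k -> iter j.+1 (p * tperm d d')%g x = iter j p d.
  elim: j => [|j IHj] jk; first by rewrite /= permM pxd' tpermR.
  rewrite iterS IHj ?(ltnW jk) // permM -iterS tpermD //.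
    by have := kmin j jk; rewrite inE eq_sym.
  by apply: contraNneq dd' => ->; rewrite porbit_iter.
have kk : iter k.+2 (p * tperm d d')%g x = d'.
  have kd : iter k.+1 p d = d by apply/set1P; rewrite -kE mem_first_return set11.
  by rewrite iterS iterE // permM -iterS kd tpermL.
rewrite (@first_return_unique _ _ _ k.+1) ?kk // => j jk.
by rewrite iterE // inE porbit_iter negbK.
Qed.

End FirstReturn.

(** * Nonseparable rotations and their duals *)

Section Darts.
Variable E : finType.
Implicit Types (J M : rmap E) (d x y a b : dart E) (S : {set E}) (p q : {perm dart E}).
Implicit Types (phi chi : dart E -> bool).

Local Notation alpha := (rev_perm E).

Lemma rev_permE d : alpha d = rev_dart d. Proof. by rewrite permE. Qed.

Lemma rev_perm2 : (alpha * alpha = 1)%g.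
Proof. by apply/permP => x; rewrite permM !rev_permE rev_dartK perm1. Qed.

Lemma rev_permV : alpha^-1%g = alpha.
Proof. by apply/eqP; rewrite eq_invg_mul rev_perm2. Qed.

Lemma mem_rev_dart S x : (rev_dart x \in darts_of S) = (x \in darts_of S).
Proof. by rewrite !inE. Qed.

Lemma same_edge x y : x.1 = y.1 -> x = y \/ x = rev_dart y.
Proof.
case: x y => [e b] [e' b'] /= <-; rewrite /rev_dart /=.
by case: b b' => [] []; [left|right|right|left].
Qed.

Lemma rev_neq x : rev_dart x != x.
Proof. by case: x => e []; rewrite xpair_eqE eqxx. Qed.

(** The face permutation of the rotation p; then [facial (facial p)] is p
    conjugated by the edge involution. *)
Definition facial p : {perm dart E} := (alpha * p^-1)%g.

Lemma facialE p x : facial p x = (p^-1)%g (rev_dart x).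
Proof. by rewrite permM rev_permE. Qed.

Lemma facial_rev p x : facial p (rev_dart (p x)) = x.
Proof. by rewrite facialE rev_dartK permK. Qed.

Lemma porbit_facial p x : porbit (p * alpha) x = porbit (facial p) x.
Proof. by rewrite -porbitV invMg rev_permV. Qed.

Lemma facial2 p x : facial (facial p) x = rev_dart (p (rev_dart x)).
Proof.
rewrite facialE -{2}[x]rev_dartK /facial invMg invgK permM rev_permV.
by rewrite rev_permE rev_dartK.
Qed.

Definition stable S p := forall x, (p x \in darts_of S) = (x \in darts_of S).

Lemma stableV S p : stable S p -> stable S p^-1.
Proof. by move=> Sp x; rewrite -{2}[x](permKV p) Sp. Qed.

Lemma stable_facial S p : stable S p -> stable S (facial p).
Proof. by move=> /stableV Sp x; rewrite facialE Sp mem_rev_dart. Qed.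

Lemma stable_porbit S p x y :
  stable S p -> porbit p x = porbit p y -> (x \in darts_of S) = (y \in darts_of S).
Proof. exact: (@preserves_porbit _ p (mem (darts_of S))). Qed.

Lemma stable_sigma J : stable (edges J) (sigma J).
Proof. by move=> x; rewrite (perm_closed _ (sigma_on J)). Qed.

(** The corner between x and p x is mixed if chi, a colouring of the edges, changes
    there.  An edge set with rotation p is nonseparable if every partition of the
    edges into two nonempty classes has at least two mixed vertices.  Taking the
    definition for rotations rather than maps lets it apply to the face permutation
    directly. *)
Definition nonseparable S p := forall chi a b, preserves alpha chi ->
  a \in darts_of S -> b \in darts_of S -> chi a -> ~~ chi b ->
  exists x y, [/\ x \in darts_of S, y \in darts_of S, chi (p x) != chi x,
                  chi (p y) != chi y & porbit p x != porbit p y].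

Lemma porbit_eq_on S p q x y : stable S p -> {in darts_of S, p =1 q} ->
  x \in darts_of S -> porbit p x = porbit p y -> porbit q x = porbit q y.
Proof.
move=> Sp pq xS /same_porbit[n ->]; rewrite -(porbit_iter q n); congr porbit.
suff /(_ n)[-> //] : forall n, iter n q x = iter n p x /\ iter n p x \in darts_of S.
by elim=> [|k [IHk kS]] //=; rewrite IHk -pq // Sp.
Qed.

Lemma nonseparable_eq S p q : stable S p -> stable S q ->
  {in darts_of S, p =1 q} -> nonseparable S p -> nonseparable S q.
Proof.
move=> Sp Sq pq ns chi a b rchi aS bS ca cb.
have [x [y [xS yS cx cy xy]]] := ns chi a b rchi aS bS ca cb.
exists x, y; split; rewrite -?pq //; apply: contraNneq xy => xy.
by apply/eqP; apply: (porbit_eq_on Sq) xy => // z zS; rewrite pq.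
Qed.

(** Whitney duality.  If chi changes at the corner from x to f x of a face, it
    changes around the vertex of v = f x; going around this vertex it must change
    back, at some w, which gives another mixed corner of a face.  If that were the
    face of x, then v and w would be two corners shared by a vertex and a face, and
    by [jordan] the rotation would be separated there by a colouring with a single
    mixed vertex. *)
Lemma dual_nonseparable S p : stable S p -> spherical p alpha ->
  nonseparable S p -> nonseparable S (facial p).
Proof.
move=> Sp sph ns chi a b rchi aS bS ca cb; set f := facial p.
have chirev z : chi (rev_dart z) = chi z by rewrite -rev_permE rchi.
have [x xS fx] : exists2 x, x \in darts_of S & chi (f x) != chi x.
  have [/exists_inP[x ? ?]|/exists_inPn nf] :=
    boolP [exists x in darts_of S, chi (f x) != chi x]; first by exists x.
  have [x [_ [xS _ px _ _]]] := ns _ _ _ rchi aS bS ca cb.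
  have := nf (rev_dart (p x)); rewrite mem_rev_dart Sp facial_rev chirev => /(_ xS).
  by rewrite negbK => /eqP e; rewrite e eqxx in px.
(* The corner of v = f x at its vertex is mixed as well. *)
set v := f x; have pv : p v = rev_dart x by rewrite /v /f facialE permKV.
have cv : chi (p v) != chi v by rewrite pv chirev eq_sym.
have [w [wv cw cpw]] := opposite_change cv.
have vS : v \in darts_of S by rewrite stable_facial.
have wS : w \in darts_of S by rewrite (stable_porbit Sp wv).
exists x, (rev_dart (p w)); split; rewrite ?mem_rev_dart ?Sp // ?facial_rev ?chirev //.
  by rewrite cw cpw.
apply/negP => /eqP; rewrite -(porbit_step f (rev_dart _)) facial_rev => xw.
have vw : v != w by apply: contraNneq cv => e; rewrite -cw -e.
have [||phi [Hp Hr phiv phiw]] := jordan sph vw.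
- by rewrite wv.
- by rewrite !porbit_facial -xw -/f porbit_step.
(* phi is preserved by p except at v and w, which belong to one vertex. *)
have corner z : phi (p z) != phi z -> porbit p z = porbit p v.
  by rewrite -[z in p z](tpermK v w) -permM Hp; case: tpermP => [->|->|]; rewrite ?eqxx.
have [y [z [_ _ /corner yv /corner zv]]] := ns phi v w Hr vS wS phiv phiw.
by rewrite yv zv eqxx.
Qed.

(** An edge with the same face on both sides is a bridge: this is [jordan] with the
    roles of vertices and edges exchanged, cutting the edge instead of a vertex. *)
Lemma edge_jordan p d : spherical p alpha ->
  porbit (facial p) d = porbit (facial p) (rev_dart d) ->
  exists phi, [/\ preserves p phi, phi d, ~~ phi (rev_dart d)
    & forall x, x.1 != d.1 -> phi (rev_dart x) = phi x].
Proof.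
move=> /spherical_inv; rewrite rev_permV => sph dd.
have [|||phi [Hr Hp phid phird]] := jordan (a := d) (b := rev_dart d) sph.
- by rewrite eq_sym rev_neq.
- by rewrite -rev_permE porbit_step.
- by [].
exists phi; split=> // [x|x xd]; first by have := preservesV Hp x; rewrite invgK.
rewrite -(Hr x) permM tpermD ?rev_permE //; by apply: contraNneq xd => <-.
Qed.

Lemma card_imset_split (T rT : finType) (f : T -> rT) (D : {set T}) :
  (forall x y : T, f x = f y -> (x \in D) = (y \in D)) ->
  #|[set f x | x : T]| = #|[set f x | x in D]| + #|[set f x | x in ~: D]|.
Proof.
move=> fD; rewrite -cardsUI [X in _ + #|pred_of_set X|](_ : _ = set0) ?cards0 ?addn0.
  by rewrite -imsetU setUCr; apply: eq_card => y; apply/imsetP/imsetP => [] [x _ ->]; exists x.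
apply/setP => C; rewrite !inE; apply/negP => /andP[/imsetP[x xD ->] /imsetP[y yD /fD]].
by rewrite inE in yD; rewrite xD (negPf yD).
Qed.

Lemma card_darts S : #|darts_of S| = 2 * #|S|.
Proof.
have -> : darts_of S = setX S [set: bool] by apply/setP => -[e c]; rewrite !inE andbT.
by rewrite cardsX cardsT card_bool mulnC.
Qed.

Lemma darts_ofC S : ~: darts_of S = darts_of (~: S).
Proof. by apply/setP => x; rewrite !inE. Qed.

Lemma card_edge_pairs S (f : dart E -> {set dart E}) :
  {in darts_of S, forall x, f x = [set x; rev_dart x]} ->
  #|[set f x | x in darts_of S]| = #|S|.
Proof.
move=> fE; have -> : f @: darts_of S = [set [set (e, false); (e, true)] | e in S].
  apply/setP => C; apply/imsetP/imsetP => [[[e c] eS ->]|[e eS ->]].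
    exists e; first by rewrite inE in eS.
    by rewrite fE //; case: c {eS} => //; rewrite setUC.
  by exists (e, false); rewrite ?fE ?inE.
rewrite card_imset // => e e' /setP/(_ (e, false)).
by rewrite !inE eqxx /= => /esym; rewrite !xpair_eqE andbT andbF orbF => /eqP.
Qed.

Lemma porbit_pair p x : p x = rev_dart x -> p (rev_dart x) = x ->
  porbit p x = [set x; rev_dart x].
Proof.
move=> px prx; apply/setP => y; rewrite !inE -eq_porbit_mem.
apply/eqP/orP => [/esym/same_porbit[n ->]|].
  by elim: n => [|n /= [] /eqP ->]; [left|right; rewrite px|left; rewrite prx].
by case=> /eqP -> //; rewrite -px porbit_step.
Qed.

Lemma porbit_eq1 p x : p x = x -> porbit p x = [set x].
Proof.
move=> px; apply/setP => y; rewrite inE; apply/porbitP/eqP => [[n ->]|->].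
  by rewrite permX; elim: n => //= n ->.
by exists 0; rewrite perm1.
Qed.

(** In [plane] only darts of the map count, while [spherical] counts orbits on all
    darts.  Each absent edge adds two darts, two vertices, one edge, one face and one
    component to the latter and thus keeps Euler's formula. *)
Lemma plane_spherical J : plane J <-> spherical (sigma J) alpha.
Proof.
have out x : x \in ~: darts J -> sigma J x = x.
  by rewrite inE; apply: out_perm (sigma_on J).
have Sf := stable_facial (@stable_sigma J).
have outf x : x \in ~: darts J -> facial (sigma J) x = rev_dart x.
  move=> xD; rewrite facialE; apply: (@perm_inj _ (sigma J)); rewrite permKV out //.
  by rewrite darts_ofC mem_rev_dart -darts_ofC.
have := cardsC (edges J); set k := #|~: edges J| => cardE.
have Ev : #|porbits (sigma J)| = #|vertices J| + 2 * k.
  rewrite /porbits (card_imset_split (D := darts J)).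
    congr addn; rewrite -(card_darts (~: _)) -darts_ofC.
    rewrite -(card_imset _ (@set1_inj (dart E))); congr #|pred_of_set _|.
    by apply: eq_in_imset => x /out/porbit_eq1.
  by move=> x y; apply: stable_porbit (@stable_sigma J).
have Er : #|porbits alpha| = #|edges J| + k.
  have fE S : {in darts_of S, forall x, porbit alpha x = [set x; rev_dart x]}.
    by move=> x _; apply: porbit_pair; rewrite rev_permE ?rev_dartK.
  rewrite /porbits (card_imset_split (D := darts J)).
    by rewrite darts_ofC !card_edge_pairs.
  move=> x y; apply: (@stable_porbit (edges J)) => z.
  by rewrite rev_permE mem_rev_dart.
have Ef : #|porbits (sigma J * alpha)| = #|faces J| + k.
  rewrite -porbitsV invMg rev_permV -/(facial _) /porbits.
  rewrite (card_imset_split (D := darts J)).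
    congr addn; rewrite darts_ofC; apply: card_edge_pairs => x.
    rewrite -darts_ofC => xD; apply: porbit_pair; rewrite outf ?rev_dartK //.
    by rewrite darts_ofC mem_rev_dart -darts_ofC.
  by move=> x y; apply: stable_porbit.
have Ec : #|joint_orbits (sigma J) alpha| = #|components J| + k.
  rewrite /joint_orbits (card_imset_split (D := darts J)).
    congr addn; last first.
      rewrite darts_ofC; apply: card_edge_pairs => x.
      rewrite -darts_ofC => xD; apply/setP => y; apply/joint_orbitP/idP => [H|].
        have nx w : w \in darts J -> (w \in [set x; rev_dart x]) = false.
          move=> wD; apply: contraTF xD; rewrite !inE negbK.
          by case/orP=> /eqP xE; rewrite xE inE in wD.
        have := H (fun z => z \in [set x; rev_dart x]); rewrite set21 => <- // z.
          have [zD|zD] := boolP (z \in darts J); last by rewrite out // inE.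
          by rewrite !nx // stable_sigma.
        by rewrite !inE rev_permE !(inv_eq (@rev_dartK E)) rev_dartK orbC.
      by rewrite !inE => /orP[] /eqP -> // phi _ rphi; rewrite -rev_permE rphi.
    congr #|pred_of_set _|; apply: eq_in_imset => x _; apply/setP => y; rewrite !inE.
    by apply: eq_connect => u v; rewrite /step_rel /= rev_permE.
  move=> x y xy; have /joint_orbit_eqP/joint_orbitP H := xy.
  apply: (H (fun z => z \in darts J)).
    exact: stable_sigma.
  by move=> z /=; rewrite rev_permE mem_rev_dart.
have cardT : #|dart E| = 2 * #|edges J| + 2 * k.
  by rewrite card_prod card_bool -cardE; lia.
rewrite /plane /spherical /euler_sum Ev Er Ef Ec cardT; lia.
Qed.

End Darts.

(** * Deletions and contractions of single edges *)

Section Maps.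
Variable E : finType.
Implicit Types (J M N K : rmap E) (d x y a b : dart E) (e : E) (S F : {set E}).
Implicit Types (p q : {perm dart E}) (phi chi : dart E -> bool).

Local Notation alpha := (rev_perm E).

Lemma rmap_eq M N : edges M = edges N -> sigma M = sigma N -> M = N.
Proof.
case: M N => [A p pA] [B q qB] /= AB pq; subst; congr RMap.
exact: eq_irrelevance.
Qed.

Definition restrict M F : rmap E := induced_map F (sigma M).

Lemma restrict_id M : restrict M (edges M) = M.
Proof. by apply: rmap_eq => //=; apply: first_return_id (sigma_on M). Qed.

Lemma restrict_restrict M S F :
  F \subset S -> restrict (restrict M S) F = restrict M F.
Proof.
move=> FS; apply: rmap_eq => //=; rewrite first_returnI; congr (first_return _ _).
apply/setP => x; rewrite !inE; case xF: (_ \in F); rewrite ?andbF //.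
by rewrite (subsetP FS _ xF).
Qed.

Lemma src_restrict M F x y : x \in darts_of F -> y \in darts_of F ->
  src (restrict M F) x = src (restrict M F) y <-> src M x = src M y.
Proof. exact: porbit_first_return. Qed.

(** Removing a dart from the rotation splits it off as an orbit of its own. *)
Lemma spherical_remove p d : spherical p alpha -> spherical (first_return p [set~ d]) alpha.
Proof.
move=> sph; suff -> : first_return p [set~ d] = (tperm (p^-1%g d) d * p)%g.
  by apply: spherical_split => //; rewrite -(porbit_step p (_ d)) permKV.
apply/permP => x; rewrite permM.
have [->|xd] := eqVneq x d; first by rewrite tpermR permKV first_return_out // !inE eqxx.
have [xE|xd'] := eqVneq x (p^-1 d)%g.
  rewrite {2}xE tpermL (@first_return_unique _ _ _ _ 1) //= ?inE // xE ?permKV //.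
    by apply: contraNneq xd => pd; rewrite xE -{1}pd permK.
  by case=> // _; rewrite /= permKV !inE eqxx.
rewrite tpermD 1?eq_sym // (@first_return_unique _ _ _ _ 0) //= !inE //.
by apply: contraNneq xd' => <-; rewrite permK.
Qed.

Lemma delete_edge_sigma M e :
  sigma (delete M [set e]) =
  first_return (first_return (sigma M) [set~ (e, false)]) [set~ (e, true)].
Proof.
rewrite first_returnI -[in RHS](first_return_id (sigma_on M)) first_returnI /=.
congr (first_return _ _); apply/setP => -[g c]; rewrite !inE /= !xpair_eqE.
by case: (g == e) c => [] []; rewrite ?andbT ?andbF.
Qed.

Lemma plane_delete M e : plane M -> plane (delete M [set e]).
Proof.
move=> /plane_spherical sph; apply/plane_spherical; rewrite delete_edge_sigma.
by do 2 apply: spherical_remove.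
Qed.

Lemma sigma_dual M x : x \in darts M -> sigma (dual M) x = facial (sigma M) x.
Proof.
move=> xM; apply: first_return_stable => //.
exact: stable_facial (@stable_sigma _ M).
Qed.

Lemma src_dual M x y : x \in darts M -> y \in darts M ->
  src (dual M) x = src (dual M) y <->
  porbit (facial (sigma M)) x = porbit (facial (sigma M)) y.
Proof. exact: porbit_first_return. Qed.

Lemma loop_in J e : is_loop J e -> e \in edges J.
Proof.
rewrite /is_loop /src => /eqP/esym/same_porbit[n eE]; apply: contraT => eJ.
have out : sigma J (e, true) = (e, true) by apply: (out_perm (sigma_on J)); rewrite inE.
by move: eE; rewrite (_ : iter n _ _ = (e, true)) //; elim: n => //= n ->.
Qed.

Lemma dual_loopP M e : reflect
  (e \in edges M /\
   porbit (facial (sigma M)) (e, false) = porbit (facial (sigma M)) (e, true))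
  (is_loop (dual M) e).
Proof.
apply: (iffP idP) => [l|[eM l]].
  have eM : e \in edges M := loop_in l.
  by split=> //; apply/src_dual; rewrite ?inE //; apply/eqP.
by apply/eqP/src_dual; rewrite ?inE.
Qed.

(** A vertex colouring that witnesses that e is a bridge: no other edge joins
    vertices of different colours. *)
Definition bridge_colouring M e phi := [/\ preserves (sigma M) phi,
  phi (e, false), ~~ phi (e, true) & forall x, x.1 != e -> phi (rev_dart x) = phi x].

Lemma dual_loop_bridge M e : plane M -> is_loop (dual M) e ->
  exists phi, bridge_colouring M e phi.
Proof.
move=> /plane_spherical sph /dual_loopP[_ /(edge_jordan sph)[phi [? ? ? ?]]].
by exists phi.
Qed.

(** The map whose dual is the dual of M with the edge e deleted.  When e is a bridge,
    it is the contraction of e, with the ends glued at the corners next to e. *)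
Definition vertex_merge M e : rmap E :=
  induced_map (edges M :\ e) (sigma M * tperm (e, false) (e, true))%g.

(** The operation on M that corresponds to [contract] on the dual of M
    ([contract_dual]): an edge between two faces is deleted; an edge with the
    same face on both sides, which is a bridge if M is plane, is contracted. *)
Definition reduce M e : rmap E :=
  if is_loop (dual M) e then vertex_merge M e else delete M [set e].

Lemma edges_reduce M e : edges (reduce M e) = edges M :\ e.
Proof. by rewrite /reduce; case: ifP. Qed.

Lemma edge_tperm e x : x.1 = e -> tperm (e, false) (e, true) x = rev_dart x.
Proof. by case: x => g [] /= ->; rewrite ?tpermL ?tpermR. Qed.

Lemma other_edge_tperm e x : x.1 != e -> tperm (e, false) (e, true) x = x.
Proof. by move=> xe; rewrite tpermD //; apply: contraNneq xe => <-. Qed.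

Lemma sigma_dual_induced S p x : x \in darts_of S ->
  sigma (dual (induced_map S p)) x = first_return p^-1 (darts_of S) (rev_dart x).
Proof. by move=> xS; rewrite sigma_dual // facialE first_returnV. Qed.

(** Both sides are first returns to the remaining darts, of permutations whose
    orbits agree up to the edge involution while they pass through the two darts
    of e. *)
Lemma contract_dual M e : contract (dual M) e = dual (reduce M e).
Proof.
have stM := @stable_sigma _ M.
have BE x : (x \in darts_of (edges M :\ e)) = (x.1 != e) && (x \in darts M) by rewrite !inE.
apply: rmap_eq; first by rewrite /contract /reduce; case: ifP.
apply/permP => x.
have [xB|xB] := boolP (x \in darts_of (edges M :\ e)); last first.
  by rewrite !(out_perm (sigma_on _)) //= ?edges_reduce //; rewrite /contract; case: ifP.
have xM : x \in darts M by move: xB; rewrite BE => /andP[].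
have rB y : (rev_dart y \in darts_of (edges M :\ e)) = (y \in darts_of (edges M :\ e)).
  exact: mem_rev_dart.
rewrite /contract /reduce; case: ifP => l.
  rewrite [RHS]sigma_dual_induced //= first_returnI.
  have -> : darts_of (edges M) :&: darts_of (edges M :\: [set e]) = darts_of (edges M :\ e).
    by apply/setP => y; rewrite !inE andbCA andbb.
  have [k [fE fB kmin]] := first_returnP (facial (sigma M)) xB.
  have iterE j : j <= k -> iter j.+1 (sigma M * tperm (e, false) (e, true))^-1%g (rev_dart x)
      = iter j.+1 (facial (sigma M)) x.
    elim: j => [|j IHj] jk.
      rewrite /= invMg tpermV permM other_edge_tperm ?facialE //=.
      by move: xB; rewrite BE => /andP[].
    rewrite iterS IHj ?(ltnW jk) // invMg tpermV permM [RHS]iterS facialE edge_tperm //.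
    have := kmin j jk; rewrite BE negb_and negbK => /orP[/eqP //|].
    case/negP; elim: j.+1 => //= i; exact: etrans (stable_facial stM _).
  rewrite fE in fB *; rewrite -iterE // (@first_return_unique _ _ _ _ k) ?rB ?iterE //.
  by move=> j jk; rewrite iterE ?kmin // ltnW.
rewrite [RHS]sigma_dual_induced //=.
have rxB : rev_dart x \in darts_of (edges M :\ e) by rewrite rB.
have [k [fE fB kmin]] := first_returnP (sigma M)^-1 rxB.
have inM j : iter j (sigma M)^-1%g (rev_dart x) \in darts M.
  by elim: j => [|j IHj] /=; rewrite ?mem_rev_dart // stableV.
have iterE j : j <= k -> iter j.+1 (sigma (dual M) * tperm (e, false) (e, true))%g x
    = tperm (e, false) (e, true) (iter j.+1 (sigma M)^-1%g (rev_dart x)).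
  elim: j => [|j IHj] jk; first by rewrite /= permM sigma_dual // facialE.
  rewrite iterS IHj ?(ltnW jk) // permM edge_tperm.
    by rewrite sigma_dual ?mem_rev_dart // facialE rev_dartK.
  by have := kmin j jk; rewrite BE inM andbT negbK => /eqP.
have iterkE : iter k.+1 (sigma (dual M) * tperm (e, false) (e, true))%g x
    = iter k.+1 (sigma M)^-1%g (rev_dart x).
  rewrite iterE // other_edge_tperm //.
  by move: fB; rewrite fE BE => /andP[].
rewrite fE in fB *; rewrite -iterkE (@first_return_unique _ _ _ _ k) ?iterkE // => j jk.
rewrite iterE ?(ltnW jk) //; have := kmin j jk; rewrite BE inM andbT negbK => /eqP je.
by rewrite edge_tperm // BE /= je eqxx.
Qed.

Lemma dual_inj M N : dual M = dual N -> M = N.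
Proof.
move=> MN; have eE : edges M = edges N by have := congr1 (@edges E) MN.
apply: rmap_eq => //; apply: invg_inj; apply/permP => x; rewrite -[x]rev_dartK -!facialE.
have [xM|xM] := boolP (rev_dart x \in darts M).
  by rewrite -!sigma_dual ?MN // /darts -eE.
rewrite !facialE rev_dartK; rewrite mem_rev_dart in xM.
have out K : edges K = edges M -> (sigma K)^-1%g x = x.
  move=> KM; apply: (@perm_inj _ (sigma K)); rewrite permKV.
  by rewrite (out_perm (sigma_on K)) // KM.
by rewrite !out.
Qed.

Lemma merge_tperm p x y :
  (p * tperm x y = tperm (p^-1%g x) (p^-1%g y) * p)%g.
Proof. by rewrite -tpermJ conjgE invgK mulgA mulgKV. Qed.

(** The ends of a bridge are distinct vertices on a common face, so that merging
    them preserves Euler's formula. *)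
Lemma plane_reduce M e : plane M -> plane (reduce M e).
Proof.
move=> pM; rewrite /reduce; case: ifP => l; last exact: plane_delete.
have [eM ef] := dual_loopP _ _ l.
have [phi [sphi phi0 phi1 _]] := dual_loop_bridge pM l.
have tM : perm_on (darts M) (sigma M * tperm (e, false) (e, true))%g.
  apply/subsetP => x; rewrite inE; apply: contraR => xM.
  rewrite permM (out_perm (sigma_on M) xM) other_edge_tperm //.
  by apply: contraNneq xM => xe; rewrite inE xe.
suff : plane (RMap tM) by move/(plane_delete e).
apply/plane_spherical => /=; rewrite merge_tperm; apply: spherical_merge.
- exact/plane_spherical.
- rewrite -(porbit_step _ (_ (e, false))) -(porbit_step _ (_ (e, true))) !permKV.
  by apply: contraTneq phi0 => /(preserves_porbit sphi) ->.
- have step c : ((sigma M * alpha) ((sigma M)^-1 (e, c)) = (e, ~~ c))%g.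
    by rewrite permM permKV rev_permE.
  by rewrite -(porbit_step _ (_ (e, false))) -(porbit_step _ (_ (e, true))) !step !porbit_facial.
Qed.

(** Merging two vertices leaves exactly the vertex colourings in which they agree. *)
Lemma merge_preserves p x y phi : porbit p x != porbit p y ->
  preserves (p * tperm x y) phi <-> preserves p phi /\ phi x = phi y.
Proof.
rewrite merge_tperm => xy; split.
  move=> Hphi; have e : phi (p^-1%g x) = phi (p^-1%g y).
    apply: (merged_preserves _ Hphi).
    by rewrite -(porbit_step p (p^-1%g x)) -(porbit_step p (p^-1%g y)) !permKV.
  have Hp : preserves p phi by apply/(preserves_tperm _ e).
  by split=> //; rewrite -[x](permKV p) -[y](permKV p) !Hp.
case=> Hp xyphi; apply/preserves_tperm => //.
by rewrite !(preservesV Hp).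
Qed.

Lemma bridge_ends M e phi : bridge_colouring M e phi ->
  porbit (sigma M) (e, false) != porbit (sigma M) (e, true).
Proof.
by case=> sphi phi0 phi1 _; apply: contraTneq phi0 => /(preserves_porbit sphi) ->.
Qed.

(** A cut of the reduced map is a cut of M with the same remaining edges: a
    contracted bridge has two ends of the same colour. *)
Lemma reduce_extend M e phi : plane M -> preserves (sigma (reduce M e)) phi ->
  exists2 psi, preserves (sigma M) psi & {in darts (reduce M e), psi =1 phi}.
Proof.
move=> pM; rewrite /reduce; case: ifP => l; last exact: first_return_extend.
have [chi chiP] := dual_loop_bridge pM l.
move=> /first_return_extend[psi Hpsi psiE]; exists psi => //.
by have [] := iffLR (merge_preserves _ (bridge_ends chiP)) Hpsi.
Qed.

(** If a cut separates the ends of e and all edges of F are on one side of it, then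
    merging the ends of e does not affect the edges of F. *)
Lemma restrict_vertex_merge M F e phi c : e \notin F -> F \subset edges M ->
  preserves (sigma M) phi -> phi (e, false) != phi (e, true) ->
  {in darts_of F, forall x, phi x = c} ->
  restrict (vertex_merge M e) F = restrict M F.
Proof.
move=> eF FM sphi phie Fphi; apply: rmap_eq => //=; rewrite first_returnI.
have -> : darts_of (edges M :\ e) :&: darts_of F = darts_of F.
  apply/setP => x; rewrite !inE; case xF: (_ \in F); rewrite ?andbF //.
  by rewrite (subsetP FM _ xF) !andbT; apply: contraNneq eF => <-.
have ends : porbit (sigma M) (e, false) != porbit (sigma M) (e, true).
  by apply: contraNneq phie => /(preserves_porbit sphi) ->.
have avoid y : phi y != c -> {in darts_of F, forall x, porbit (sigma M) x != porbit (sigma M) y}.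
  by move=> yc x /Fphi xc; apply: contraNneq yc => /(preserves_porbit sphi) <-; rewrite xc.
have [e0c|e0c] := eqVneq (phi (e, false)) c.
  rewrite tpermC; apply: first_return_mul_tperm; rewrite 1?eq_sym //.
  by apply: avoid; rewrite -e0c eq_sym.
by apply: first_return_mul_tperm => //; apply: avoid.
Qed.

(** A nonseparable part F is connected, so it lies on one side of each cut that
    avoids F. *)
Lemma nonseparable_constant M F phi a b : nonseparable F (sigma (restrict M F)) ->
  preserves (sigma M) phi -> {in darts_of F, forall x, phi (rev_dart x) = phi x} ->
  a \in darts_of F -> b \in darts_of F -> phi a = phi b.
Proof.
move=> ns sphi rphi.
suff key u v : u \in darts_of F -> v \in darts_of F -> phi u -> phi v.
  by move=> aF bF; apply/idP/idP; apply: key.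
move=> uF vF pu; apply: contraT => pv.
pose chi x := (x \in darts_of F) && phi x.
have rchi : preserves alpha chi.
  by move=> x; rewrite /chi rev_permE mem_rev_dart; case: (boolP (_ \in _)) => // /rphi.
have [||x [_ [xF _ + _ _]]] := ns chi u v rchi uF vF; rewrite /chi ?uF ?vF //.
by rewrite mem_first_return xF (first_return_preserves _ sphi) eqxx.
Qed.

(** Going down: a nonseparable part of M lies on one side of any bridge outside it,
    so it survives unchanged. *)
Lemma restrict_reduce M F e : plane M -> F \subset edges M -> e \notin F ->
  nonseparable F (sigma (restrict M F)) -> restrict (reduce M e) F = restrict M F.
Proof.
move=> pM FM eF ns; rewrite /reduce; case: ifP => l; last first.
  by rewrite restrict_restrict // subsetD1 FM.
have [phi [sphi phi0 phi1 rphi]] := dual_loop_bridge pM l.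
have [F0|[g gF]] := set_0Vmem F.
  by apply: (restrict_vertex_merge eF FM (c := true) sphi) => [|x];
    rewrite ?phi0 // F0 !inE.
apply: (restrict_vertex_merge eF FM (c := phi (g, true)) sphi).
  by rewrite phi0; case: (phi _) phi1.
move=> x xF; apply: (nonseparable_constant ns sphi) => //; last by rewrite inE.
by move=> y; rewrite inE => yF; apply: rphi; apply: contraNneq eF => <-.
Qed.

(** Going up: a nonseparable part of the reduced map is also a part of M.  If it
    used edges from both sides of a contracted bridge, then it would be separated
    at the vertex obtained from the bridge. *)
Lemma unrestrict_reduce M F e : plane M -> F \subset edges (reduce M e) ->
  nonseparable F (sigma (restrict (reduce M e) F)) ->
  restrict (reduce M e) F = restrict M F.
Proof.
rewrite edges_reduce => pM; rewrite subsetD1 => /andP[FM eF].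
rewrite /reduce; case: ifP => l ns; last first.
  by rewrite restrict_restrict // subsetD1 FM.
have [phi phiP] := dual_loop_bridge pM l; have ends := bridge_ends phiP.
have [sphi phi0 phi1 rphi] := phiP.
have phie : phi (e, false) != phi (e, true) by rewrite phi0; case: (phi _) phi1.
have [/exists_inP[a aF pa]|/exists_inPn na] := boolP [exists x in darts_of F, phi x]; last first.
  by apply: (restrict_vertex_merge eF FM (c := false) sphi) => // x /na/negPf.
have [/exists_inP[b bF pb]|/exists_inPn nb] := boolP [exists x in darts_of F, ~~ phi x]; last first.
  by apply: (restrict_vertex_merge eF FM (c := true) sphi) => // x /nb; rewrite negbK.
pose chi x := (x.1 \in F) && phi x.
have rchi : preserves alpha chi.
  move=> x; rewrite /chi rev_permE /=; case xF: (_ \in F) => //=.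
  by apply: rphi; apply: contraNneq eF => <-.
have ca : chi a by rewrite /chi pa andbT; rewrite inE in aF.
have cb : ~~ chi b by rewrite /chi negb_and pb orbT.
have [x [y [xF yF cx cy]]] := ns chi a b rchi aF bF ca cb.
set q := (sigma M * tperm (e, false) (e, true))%g.
have qends : porbit q (e, true) = porbit q (e, false).
  have [_ /=] := iffLR (merge_preserves _ ends) (preserves_mem_porbit q (e, false)).
  by rewrite eqxx => /esym/eqP.
have NE : sigma (restrict (vertex_merge M e) F) = first_return q (darts_of F).
  rewrite /= first_returnI; congr (first_return _ _).
  apply/setP => z; rewrite !inE; case zF: (_ \in F); rewrite ?andbF //.
  by rewrite (subsetP FM _ zF) !andbT; apply: contraNneq eF => <-.
(* Away from the vertex that the ends of e are porbit_tperm_merged into, the rotation q is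
   that of M, which preserves phi; so both mixed corners lie at this vertex. *)
have corner z : z \in darts_of F -> chi (first_return q (darts_of F) z) != chi z ->
    porbit q z = porbit q (e, false).
  move=> zF; have fzF := zF; rewrite -(mem_first_return q) in fzF.
  rewrite /chi; move: (zF) (fzF); rewrite !inE => -> -> /= cz.
  apply/eqP; apply: contraNT cz => zq.
  pose psi w := phi w && (porbit q w != porbit q (e, false)).
  have qpsi : preserves q psi.
    move=> w; rewrite /psi porbit_step.
    have [_|wq] := eqVneq (porbit q w); rewrite ?andbF //.
    have qw : q w = sigma M w.
      rewrite permM tpermD //; apply: contraNneq wq => we.
        by rewrite -(porbit_step q w) permM -we tpermL qends.
      by rewrite -(porbit_step q w) permM -we tpermR.
    by rewrite qw sphi.
  have := first_return_preserves (darts_of F) qpsi z.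
  by rewrite /psi porbit_first_return_step zq !andbT => ->.
move: cx cy; rewrite NE => /(corner _ xF) qx /(corner _ yF) qy /eqP[].
by apply/porbit_first_return => //; rewrite qx qy.
Qed.

End Maps.

(** * Nonseparability of 2-connected maps *)

Section TwoConnected.
Variable E : finType.
Implicit Types (J M N K : rmap E) (d x y a b : dart E) (e : E) (S F : {set E}).
Implicit Types (p q : {perm dart E}) (phi chi : dart E -> bool).
Implicit Types (u v z : {set dart E}) (w s : seq (dart E)).

Local Notation alpha := (rev_perm E).

Lemma other_edge S e : 1 < #|S| -> exists2 g, g \in S & g != e.
Proof.
move=> /card_gt1P[g [h [gS hS gh]]]; have [ge|] := eqVneq g e; last by exists g.
by exists h => //; rewrite -ge eq_sym.
Qed.

(** If d were a bridge, then the edges other than d on one side of it would meet the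
    other edges only at the end of d on that side.  With two edges at least, one of
    the sides has such an edge. *)
Lemma nonseparable_bridgeless S p d phi : stable S p -> nonseparable S p ->
  1 < #|S| -> d \in darts_of S -> preserves p phi ->
  {in darts_of S, forall x, x.1 != d.1 -> phi (rev_dart x) = phi x} ->
  phi d = phi (rev_dart d).
Proof.
move=> Sp ns S2 dS.
have key f psi x : f \in darts_of S -> preserves p psi ->
    {in darts_of S, forall x, x.1 != f.1 -> psi (rev_dart x) = psi x} ->
    psi f -> ~~ psi (rev_dart f) -> x \in darts_of S -> x.1 != f.1 -> ~~ psi x.
  move=> fS ppsi rpsi pf prf xS xf; apply/negP => px.
  pose chi y := [&& y \in darts_of S, y.1 != f.1 & psi y].
  have rchi : preserves alpha chi.
    move=> y; rewrite /chi rev_permE mem_rev_dart; case: (boolP (y \in _)) => //= yS.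
    by case: (boolP (_ != _)) => //= /(rpsi _ yS).
  have corner y : y \in darts_of S -> chi (p y) != chi y -> porbit p y = porbit p f.
    move=> yS; rewrite /chi Sp yS ppsi /=; case py: (psi y); rewrite ?andbF // !andbT.
    have [/same_edge[->|yE]|_] := eqVneq y.1 f.1; first by [].
      by rewrite yE (negPf prf) in py.
    have [/same_edge[<-|yE]|//] := eqVneq (p y).1 f.1; first by rewrite porbit_step.
    by rewrite -ppsi yE (negPf prf) in py.
  have [||y [z [yS zS /(corner _ yS) -> /(corner _ zS) ->]]] := ns chi x f rchi xS fS.
  - by rewrite /chi xS xf.
  - by rewrite /chi eqxx andbF.
  by rewrite eqxx.
have key2 f psi : f \in darts_of S -> preserves p psi ->
    {in darts_of S, forall x, x.1 != f.1 -> psi (rev_dart x) = psi x} ->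
    psi f -> psi (rev_dart f).
  move=> fS ppsi rpsi pf; apply: contraT => prf; have [g gS gf] := other_edge f.1 S2.
  have gS' : (g, true) \in darts_of S by rewrite inE.
  have ng := key f psi _ fS ppsi rpsi pf prf gS' gf.
  suff : ~~ (negb \o psi) (g, true) by rewrite /= ng.
  apply: (key (rev_dart f)) => //=; rewrite ?mem_rev_dart //.
  - by move=> y /=; rewrite ppsi.
  - by move=> y yS yf; rewrite rpsi.
  - by rewrite rev_dartK negbK.
move=> pphi rphi; apply/idP/idP; first exact: key2.
rewrite -{2}[d]rev_dartK; apply: key2 => //; by rewrite mem_rev_dart.
Qed.

Lemma vertexP J u : reflect (exists2 d, d \in darts J & u = src J d) (u \in vertices J).
Proof. exact: imsetP. Qed.

(** If a partition of the edges has at most one mixed vertex z, choose an end other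
    than z of an edge of each class; this is possible since there are no loops.
    A path between the chosen vertices changes the class at some inner vertex,
    which must be z, so two such paths are not internally disjoint. *)
Lemma two_connected_nonseparable J :
  loopless J -> two_connected J -> nonseparable (edges J) (sigma J).
Proof.
move=> ll [_ conn] chi a b rchi aJ bJ ca cb.
have chirev x : chi (rev_dart x) = chi x by rewrite -rev_permE rchi.
pose mixed x := (x \in darts J) && (chi (sigma J x) != chi x).
have [/existsP[x /existsP[y /and3P[/andP[? ?] /andP[? ?] ?]]]|/existsPn one] :=
  boolP [exists x, exists y, [&& mixed x, mixed y & src J x != src J y]].
  by exists x, y.
(* The only mixed vertex; the default set0 is no vertex. *)
pose z := if [pick x | mixed x] is Some x then src J x else set0.
have zP x : mixed x -> src J x = z.
  move=> mx; rewrite /z; case: pickP => [y my|/(_ x)]; last by rewrite mx.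
  have /existsPn/(_ y) := one x; rewrite mx my /=; by rewrite negbK => /eqP.
have const x y : x \in darts J -> src J x != z -> src J x = src J y -> chi x = chi y.
  move=> xJ xz /same_porbit[n ->]; elim: n => //= n ->.
  apply/eqP; apply: contraNT xz => ch.
  have : mixed (iter n (sigma J) x).
    rewrite /mixed eq_sym ch andbT.
    by have := stable_porbit (@stable_sigma _ J) (porbit_iter (sigma J) n x) => ->.
  by move/zP => <-; rewrite /src porbit_iter.
have nloop x : x \in darts J -> src J x != src J (rev_dart x).
  case: x => e c; rewrite inE => /ll; rewrite /is_loop.
  by case: c => //; rewrite eq_sym.
have off x : x \in darts J -> exists y, [/\ y \in darts J, chi y = chi x & src J y != z].
  move=> xJ; have [xz|] := eqVneq (src J x) z; last by exists x.
  exists (rev_dart x); split; rewrite ?mem_rev_dart ?chirev // -xz eq_sym.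
  exact: nloop.
have [a' [a'J ca' a'z]] := off _ aJ; have [b' [b'J cb' b'z]] := off _ bJ.
have ab : src J a' != src J b'.
  by apply: contraNneq cb => /(const _ _ a'J a'z); rewrite ca' cb' => <-.
have [w [w' [_ /andP[ww uw] /andP[ww' uw'] disj]]] :=
  conn (src J a') (src J b') (imset_f _ a'J) (imset_f _ b'J) ab.
have cross s : walk J (src J a') s (src J b') -> z \in map (src J) s.
  have cab : chi a' != chi b' by rewrite ca' cb' ca; case: (chi b) cb.
  elim: s a' a'J a'z cab {ca' ab ww ww' uw uw' w w' disj} => [|d s IHs] c cJ cz ccb /=.
    by move=> /eqP /(const _ _ cJ cz) cE; rewrite cE eqxx in ccb.
  case/and3P=> dJ /eqP dc ws; rewrite inE dc.
  have [tz|tz] := eqVneq (tgt J d) z.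
    case: s ws {IHs} => [/eqP tb|f s /= /and3P[_ /eqP -> _]].
      by rewrite -tb tz eqxx in b'z.
    by rewrite tz inE eqxx orbT.
  rewrite (IHs (rev_dart d)) ?orbT ?mem_rev_dart // chirev.
  by rewrite -(const _ _ cJ cz (esym dc)).
have inner s : walk J (src J a') s (src J b') -> z \in inner_vertices J s.
  move=> ws; have := cross s ws; case: s ws => //= d s /and3P[_ /eqP -> _].
  by rewrite inE eq_sym (negPf a'z).
by move/hasPn: disj => /(_ _ (inner _ ww')) /=; rewrite inner.
Qed.

Lemma nonloop J d : loopless J -> d \in darts J -> src J d != src J (rev_dart d).
Proof.
case: d => e c ll; rewrite inE => /ll; rewrite /is_loop.
by case: c => //; rewrite eq_sym.
Qed.

Lemma two_connected_edges J : loopless J -> two_connected J -> 1 < #|edges J|.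
Proof.
move=> ll [/card_gt1P[u [v [uJ vJ uv]]] conn].
have two d f : d \in darts J -> f \in darts J -> d.1 != f.1 -> 1 < #|edges J|.
  by rewrite !inE => dJ fJ df; apply/card_gt1P; exists d.1, f.1.
have second d f s : walk J u [:: d, f & s] v -> uniq (u :: map (tgt J) [:: d, f & s]) ->
    1 < #|edges J|.
  case/and3P=> dJ /eqP du /and3P[fJ /eqP fd _] /andP[uN _].
  apply: (two d f) => //; apply/eqP => /same_edge[df|df].
    by have := nonloop ll dJ; rewrite -/(tgt J d) -fd df eqxx.
  by move: uN; rewrite !inE -du df /tgt eqxx orbT.
have [[|d s] [[|d' s'] []]] := conn u v uJ vJ uv.
- by [].
- by move=> _ /andP[/eqP uE]; rewrite uE eqxx in uv.
- by move=> _ _ /andP[/eqP uE]; rewrite uE eqxx in uv.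
move=> ww' /andP[wd ud] /andP[wd' ud'] _.
case/and3P: (wd) => dJ /eqP du _; case/and3P: (wd') => d'J /eqP d'u _.
have [/same_edge[dd'|dd']|] := eqVneq d.1 d'.1; last exact: two.
  case: s s' ww' wd ud wd' ud' => [|f s] [|f' s'] ww' wd ud wd' ud'.
  - by rewrite dd' eqxx in ww'.
  - exact: second wd' ud'.
  - exact: second wd ud.
  - exact: second wd ud.
by have := nonloop ll d'J; rewrite -dd' du d'u eqxx.
Qed.

(** The partition of the edges into e and the rest: its mixed vertices are
    ends of e, and there are two of them. *)
Lemma nonseparable_mixed_edge J e : nonseparable (edges J) (sigma J) ->
  1 < #|edges J| -> e \in edges J ->
  exists x y, [/\ x \in darts J, y \in darts J, src J x != src J y,
    src J x \in [:: src J (e, false); src J (e, true)]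
    & src J y \in [:: src J (e, false); src J (e, true)]].
Proof.
move=> ns E2 eJ; have [g gJ ge] := other_edge e E2.
have rchi : preserves alpha (fun x => x.1 == e) by move=> x; rewrite rev_permE.
have [||||x [y [xJ yJ cx cy xy]]] := ns _ (e, false) (g, false) rchi; rewrite ?inE //=.
have corner f : ((sigma J f).1 == e) != (f.1 == e) ->
    src J f \in [:: src J (e, false); src J (e, true)].
  have end_src c : src J (e, c) \in [:: src J (e, false); src J (e, true)].
    by case: c; rewrite !inE eqxx ?orbT.
  have [ze _|_ ] := eqVneq f.1 e; first by case: f ze => h c /= ->.
  rewrite /src -porbit_step; case: (sigma J f) => h c /=.
  by rewrite eqbF_neg negbK => /eqP ->; apply: end_src.
by exists x, y; split=> //; apply: corner.
Qed.

Lemma nonseparable_loopless J :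
  nonseparable (edges J) (sigma J) -> 1 < #|edges J| -> loopless J.
Proof.
move=> ns E2 e eJ; apply/negP => /eqP l.
have [x [y [_ _ xy]]] := nonseparable_mixed_edge ns E2 eJ.
by rewrite -l !inE !orbb => /eqP xE /eqP yE; rewrite xE yE eqxx in xy.
Qed.

End TwoConnected.

(** * Whitney's theorem on disjoint paths *)

Section Walks.
Variable E : finType.
Implicit Types (J : rmap E) (d f : dart E) (u v x y z : {set dart E}) (w s t : seq (dart E)).

Local Notation alpha := (rev_perm E).

Lemma walk_cat J u v s t : walk J u (s ++ t) v ->
  exists2 x, walk J u s x & walk J x t v.
Proof.
elim: s u => [|d s IHs] u /= => [|/and3P[dJ du /IHs[x sx xt]]]; first by exists u.
by exists x; rewrite ?dJ ?du.
Qed.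

Lemma cat_walk J u x v s t : walk J u s x -> walk J x t v -> walk J u (s ++ t) v.
Proof.
elim: s u => [|d s IHs] u /= => [/eqP -> //|/and3P[-> -> /IHs st] /st].
by [].
Qed.

Lemma walk_srcs J u w v : walk J u w v -> u :: map (tgt J) w = rcons (map (src J) w) v.
Proof.
by elim: w u => [|d w IHw] u /= => [/eqP -> //|/and3P[_ /eqP -> /IHw <-]].
Qed.

Lemma mem_inner J u w v x : is_path J u w v ->
  (x \in inner_vertices J w) = [&& x \in u :: map (tgt J) w, x != u & x != v].
Proof.
case: w => [|d w] /andP[ww uw].
  by rewrite /inner_vertices /= !inE; case: eqVneq.
have inE' : map (src J) (d :: w) = u :: inner_vertices J (d :: w).
  by case/and3P: ww => _ /eqP <- _.
rewrite (walk_srcs ww) inE' rcons_cons in uw *; move: (inner_vertices _ _) uw => s.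
rewrite cons_uniq rcons_uniq !inE mem_rcons inE negb_or => /and3P[/andP[uv uN] vN _].
have [->|xu] /= := eqVneq x u; first by rewrite (negPf uN).
by have [xv|xv] := eqVneq x v; rewrite mem_rcons inE ?xv ?(negPf vN) ?andbT ?andbF ?(negPf xv).
Qed.

Lemma internally_disjointP J u v w w' : is_path J u w v -> is_path J u w' v ->
  reflect (forall x, x \in u :: map (tgt J) w -> x \in u :: map (tgt J) w' ->
                     x = u \/ x = v)
          (internally_disjoint J w w').
Proof.
move=> pw pw'; apply: (iffP hasPn) => [dis x xw xw'|dis x].
  have [->|xu] := eqVneq x u; first by left.
  have [->|xv] := eqVneq x v; first by right.
  by have := dis x; rewrite /= !(mem_inner _ pw, mem_inner _ pw') xw xw' xu xv => /(_ isT).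
rewrite /= (mem_inner _ pw') (mem_inner _ pw) => /and3P[xw' xu xv].
by apply/negP => /and3P[xw _ _]; case: (dis x xw xw') => xE; rewrite xE eqxx in xu xv.
Qed.

Definition joins J (S : {set dart E}) : rel {set dart E} :=
  [rel u v | [exists d in S, (src J d == u) && (tgt J d == v)]].

Lemma reach_path J (S : {set dart E}) u v : S \subset darts J ->
  connect (joins J S) u v -> exists2 w, is_path J u w v & {subset w <= S}.
Proof.
move=> SJ /connectP[s0 /shortenP[s us su _] ->] {s0}.
suff [w [ww tw wS]] : exists w,
  [/\ walk J u w (last u s), map (tgt J) w = s & {subset w <= S}].
  by exists w; rewrite // /is_path ww tw.
elim: s u us {su} => [|x s IHs] u /= => [_|/andP[/exists_inP[d dS /andP[du dx]] /IHs[w [ww tw wS]]]].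
  by exists [::]; split=> //=; apply: eqxx.
exists (d :: w); split=> [|/=|f]; last by rewrite inE => /orP[/eqP ->|/wS].
  by rewrite /= (subsetP SJ _ dS) du (eqP dx).
by rewrite (eqP dx) tw.
Qed.

(** Let R be the set of vertices that can be reached from u without z.  If v is not
    in R, the edges with an end in R and the other edges meet only at z. *)
Lemma avoid_vertex J u v z : nonseparable (edges J) (sigma J) ->
  u \in vertices J -> v \in vertices J -> u != z -> v != z ->
  exists2 w, is_path J u w v & z \notin u :: map (tgt J) w.
Proof.
move=> ns uJ vJ uz vz.
pose S := [set d in darts J | (src J d != z) && (tgt J d != z)].
have SJ : S \subset darts J by apply/subsetP => d /setIdP[].
suff uv : connect (joins J S) u v.
  have [w pw wS] := reach_path SJ uv; exists w => //.
  rewrite inE eq_sym negb_or uz; apply/mapP => -[d /wS]; rewrite inE => /and3P[_ _ dz] zE.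
  by rewrite -zE eqxx in dz.
pose R x := connect (joins J S) u x; apply: contraT => nuv.
have RS d : d \in S -> R (src J d) -> R (tgt J d).
  move=> dS; move/connect_trans; apply; apply: connect1.
  by apply/exists_inP; exists d => //; rewrite !eqxx.
have tgt_rev d : tgt J (rev_dart d) = src J d by rewrite /tgt rev_dartK.
have Rz : ~~ R z.
  apply/negP => /(reach_path SJ)[w /andP[ww _] wS]; case/lastP: w ww wS => [/eqP uE|w d].
    by rewrite uE eqxx in uz.
  rewrite -cats1 => /walk_cat[x _ /= /and3P[_ _ /eqP dz]] /(_ d).
  by rewrite mem_cat mem_head orbT inE dz eqxx !andbF => /(_ isT).
pose chi d := R (src J d) || R (tgt J d).
have rchi : preserves alpha chi by move=> d; rewrite rev_permE /chi tgt_rev orbC.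
have off d : d \in darts J -> ~~ R (src J d) -> chi d -> src J d = z.
  move=> dJ nR; rewrite /chi (negPf nR) /= => Rd; apply/eqP; apply: contraNT nR => dz.
  have := RS (rev_dart d); rewrite tgt_rev; apply=> //.
  rewrite inE mem_rev_dart dJ tgt_rev dz andbT /=.
  by apply: contraNneq Rz => <-.
have corner d : d \in darts J -> chi (sigma J d) != chi d -> src J d = z.
  move=> dJ; have sE : src J (sigma J d) = src J d by apply: porbit_step.
  have [Rd|nR] := boolP (R (src J d)); first by rewrite /chi sE Rd eqxx.
  case cd: (chi d); first by move=> _; apply: off.
  case cs: (chi (sigma J d)) => // _; rewrite -sE; apply: off; rewrite ?sE //.
  by rewrite stable_sigma.
have /vertexP[a aJ uE] := uJ; have /vertexP[b bJ vE] := vJ.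
have [||x [y [xJ yJ /(corner _ xJ) xz /(corner _ yJ) yz]]] := ns chi a b rchi aJ bJ.
- by rewrite /chi -uE /R connect0.
- apply/negP => /(off _ bJ) bz; have := vz; rewrite vE bz ?eqxx // -vE; exact: nuv.
by rewrite -/(src J x) -/(src J y) xz yz eqxx.
Qed.

(** Otherwise the vertices reached without the edge of d would show that it is a
    bridge. *)
Lemma avoid_edge J d : nonseparable (edges J) (sigma J) -> 1 < #|edges J| ->
  d \in darts J -> exists2 w, is_path J (src J d) w (tgt J d) & d \notin w.
Proof.
move=> ns E2 dJ; pose S := [set f in darts J | f.1 != d.1].
have SJ : S \subset darts J by apply/subsetP => f /setIdP[].
suff uv : connect (joins J S) (src J d) (tgt J d).
  have [w pw wS] := reach_path SJ uv; exists w => //.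
  by apply/negP => /wS; rewrite inE eqxx andbF.
pose phi f := connect (joins J S) (src J d) (src J f).
rewrite -[connect _ _ _]/(phi (rev_dart d)) -(nonseparable_bridgeless (phi := phi) _ ns E2 dJ).
- exact: connect0.
- exact: stable_sigma.
- by move=> f; rewrite /phi /src porbit_step.
have step f : f \in S -> phi f -> phi (rev_dart f).
  move=> fS; move/connect_trans; apply; apply: connect1.
  by apply/exists_inP; exists f => //; rewrite !eqxx.
move=> f fJ fd; have fS : f \in S by rewrite inE fJ.
have rfS : rev_dart f \in S by rewrite inE mem_rev_dart fJ.
by apply/idP/idP => [/(step _ rfS)|/(step _ fS)]; rewrite ?rev_dartK.
Qed.

Lemma walk_end J u w v : walk J u w v -> v \in u :: map (tgt J) w.
Proof. by move=> /walk_srcs ->; rewrite mem_rcons mem_head. Qed.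

Lemma last_visit J (A : pred {set dart E}) u w v :
  walk J u w v -> has A (u :: map (tgt J) w) -> exists s t x,
  [/\ w = s ++ t, walk J u s x, walk J x t v, A x & ~~ has A (map (tgt J) t)].
Proof.
elim: w u => [|d w IHw] u /=.
  by move=> uv; rewrite orbF => Au; exists [::], [::], u; split=> //=; apply: eqxx.
case/and3P=> dJ du ww; have [Aw _|nAw] := boolP (A (tgt J d) || has A (map (tgt J) w)).
  have [s [t [x [-> us xt Ax nA]]]] := IHw _ ww Aw.
  by exists (d :: s), t, x; split=> //=; rewrite dJ du.
rewrite orbF => Au; exists [::], (d :: w), u; split=> //=.
by rewrite dJ du.
Qed.

Lemma split_walk J u w v x : walk J u w v -> x \in u :: map (tgt J) w ->
  exists s t, [/\ w = s ++ t, walk J u s x & walk J x t v].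
Proof.
move=> ww xw; have [|s [t [y [wE us yt /eqP yx _]]]] := last_visit (A := pred1 x) ww.
  by apply/hasP; exists x => //=.
by exists s, t; rewrite -yx.
Qed.

Definition linked J u v := exists w w',
  [/\ w != w', is_path J u w v, is_path J u w' v & internally_disjoint J w w'].

(** The step of Whitney's argument.  Two disjoint paths p and q lead from u to a
    neighbour of the target, and r leaves p at x to reach the target without meeting
    p and q again.  Then p up to x followed by r, and q followed by the edge d, are
    disjoint. *)
Lemma relink J u d p q r x : d \in darts J -> u != src J d -> u != tgt J d ->
  is_path J u p (src J d) -> is_path J u q (src J d) -> internally_disjoint J p q ->
  walk J x r (tgt J d) -> uniq (map (tgt J) r) -> x \in u :: map (tgt J) p ->
  x != src J d -> src J d != tgt J d ->
  {in map (tgt J) r, forall y,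
    (y \notin u :: map (tgt J) p) && (y \notin u :: map (tgt J) q)} ->
  linked J u (tgt J d).
Proof.
set z := src J d; set v := tgt J d => dJ uz uv pp pq.
move=> /(internally_disjointP pp pq) disj xr ur xp xz zv rpq.
case/andP: (pp) => wp up; case/andP: (pq) => wq uq.
have [p1 [p2 [pE up1 xp2]]] := split_walk wp xp.
have sub1 y : y \in u :: map (tgt J) p1 -> y \in u :: map (tgt J) p.
  by rewrite pE map_cat -cat_cons mem_cat => ->.
have zp2 : z \in map (tgt J) p2.
  by have := walk_end xp2; rewrite inE eq_sym (negPf xz).
have zp1 : z \notin u :: map (tgt J) p1.
  move: up; rewrite pE map_cat -cat_cons cat_uniq => /and3P[_ /hasPn/(_ _ zp2)] //.
have zp : z \in u :: map (tgt J) p := walk_end wp.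
have zr : z \notin map (tgt J) r by apply/negP => /rpq /andP[/negP].
have vq : v \notin u :: map (tgt J) q.
  have := walk_end xr; rewrite inE => /orP[/eqP vx|/rpq /andP[]//].
  apply/negP => vq; have vp : v \in u :: map (tgt J) p by rewrite vx.
  by case: (disj v vp vq) => vE; [rewrite vE eqxx in uv|rewrite vE eqxx in zv].
have P1 : is_path J u (p1 ++ r) v.
  rewrite /is_path (cat_walk up1 xr) map_cat -cat_cons cat_uniq ur andbT.
  rewrite andTb; apply/andP; split.
    by move: up; rewrite pE map_cat -cat_cons cat_uniq => /and3P[].
  by apply/hasPn => y /rpq /andP[yp _]; apply: contra yp; apply: sub1.
have P2 : is_path J u (rcons q d) v.
  apply/andP; split; last by rewrite map_rcons -rcons_cons rcons_uniq vq uq.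
  by rewrite -cats1 (cat_walk wq) //= dJ !eqxx.
exists (p1 ++ r), (rcons q d); split=> //.
  apply: contraNneq zp1 => W; have zW := walk_srcs (proj1 (andP P1)).
  have : z \in map (src J) (p1 ++ r) by rewrite W map_rcons mem_rcons mem_head.
  move=> zS; have : z \in u :: map (tgt J) (p1 ++ r) by rewrite zW mem_rcons inE zS orbT.
  by rewrite map_cat -cat_cons mem_cat (negPf zr) orbF.
apply/(internally_disjointP P1 P2) => y.
rewrite map_cat -cat_cons mem_cat map_rcons -rcons_cons mem_rcons.
rewrite [y \in tgt J d :: _]inE => /orP[yp|yr].
  move=> /orP[/eqP ->|yq]; first by right.
  left; case: (disj y (sub1 _ yp) yq) => // yz.
  by rewrite yz (negPf zp1) in yp.
move=> /orP[/eqP ->|yq]; first by right.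
by have /andP[_ /negP] := rpq y yr.
Qed.

(** Whitney's theorem, by induction along a path from u: the pair of disjoint paths
    is moved over an edge d by means of a path that avoids the source of d, from its
    last vertex on the pair.  If the path consists of one edge, the second path is
    one that avoids this edge. *)
Lemma nonseparable_two_connected J : nonseparable (edges J) (sigma J) ->
  1 < #|edges J| -> two_connected J.
Proof.
move=> ns E2; have ll := nonseparable_loopless ns E2.
split.
  have [e eJ] : exists e, e \in edges J by apply/card_gt0P; apply: ltnW.
  have [a [b [aJ bJ ab _ _]]] := nonseparable_mixed_edge ns E2 eJ.
  by apply/card_gt1P; exists (src J a), (src J b); rewrite !imset_f.
move=> u v uJ vJ; pose joined := connect (joins J (darts J)) u.
have step d : d \in darts J -> joined (src J d) -> joined (tgt J d).
  move=> dJ /connect_trans; apply; apply: connect1.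
  by apply/exists_inP; exists d => //; rewrite !eqxx.
have uv : joined v.
  have /vertexP[a aJ uE] := uJ; have /vertexP[b bJ ->] := vJ.
  rewrite -[joined _]/((joined \o src J) b).
  rewrite -(@nonseparable_constant _ J (edges J) (joined \o src J) a b) //=.
  - by rewrite -uE; apply: connect0.
  - by rewrite first_return_id ?sigma_on.
  - by move=> d; rewrite /= /src porbit_step.
  move=> d dJ; apply/idP/idP => [/step|/step]; last exact.
  by rewrite mem_rev_dart /tgt rev_dartK; apply.
case/(reach_path (subxx _)): uv => w /andP[ww _] _.
elim/last_ind: w v vJ ww => [|w d IHw] v vJ.
  by move=> /eqP -> /eqP.
rewrite -cats1 => /walk_cat[z uz /= /and3P[dJ /eqP dz /eqP <-]] uv; subst z.
have dl : src J d != tgt J d by apply: nonloop.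
have [uE|nu] := eqVneq u (src J d).
  have [p pp dp] := avoid_edge ns E2 dJ.
  exists p, [:: d]; rewrite uE; split=> //; first by apply: contraNneq dp => ->; rewrite mem_head.
    by rewrite /is_path /= dJ !eqxx /= inE dl.
have zJ : src J d \in vertices J by apply: imset_f.
have [p [q [_ pp pq dis]]] := IHw _ zJ uz nu.
have tJ : tgt J d \in vertices J by apply: imset_f; rewrite mem_rev_dart.
have [|r /andP[wr ur] zr] := avoid_vertex ns uJ tJ nu; first by rewrite eq_sym.
(* The last vertex of r on the union of p and q. *)
pose A y := (y \in u :: map (tgt J) p) || (y \in u :: map (tgt J) q).
have [|s [t [x [rE us xt Ax nA]]]] := last_visit (A := A) wr.
  by rewrite /= /A mem_head.
have xz : x != src J d.
  apply: contraNneq zr => <-; have := walk_end us.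
  by rewrite rE map_cat -cat_cons mem_cat => ->.
have ut : uniq (map (tgt J) t).
  by move: ur; rewrite rE map_cat -cat_cons cat_uniq => /and3P[].
have tA : {in map (tgt J) t, forall y, ~~ A y} by apply/hasPn.
case/orP: Ax => [xp|xq].
  by apply: (relink dJ nu uv pp pq dis xt ut xp xz dl) => y /tA; rewrite /A negb_or.
rewrite /internally_disjoint has_sym in dis.
apply: (relink dJ nu uv pq pp dis xt ut xq xz dl) => y /tA.
by rewrite /A negb_or andbC.
Qed.

End Walks.

(** * Cycles of the dual and cuts *)

Section DualCycles.
Variable E : finType.
Implicit Types (G H J K L M N : rmap E) (d x y a b : dart E) (e : E) (S F : {set E}).
Implicit Types (p q : {perm dart E}) (phi psi chi : dart E -> bool).
Implicit Types (c s w : seq (dart E)) (l : seq E) (u v : {set dart E}).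

Local Notation alpha := (rev_perm E).

Lemma foldl_contract_dual M l :
  foldl (@contract E) (dual M) l = dual (foldl (@reduce E) M l).
Proof. by elim: l M => //= e l IHl M; rewrite contract_dual. Qed.

Lemma edges_foldl_reduce M l : edges (foldl (@reduce E) M l) = edges M :\: [set e in l].
Proof.
elim: l M => [|e l IHl] M /=; first by apply/setP => e; rewrite !inE.
rewrite IHl edges_reduce; apply/setP => g; rewrite !inE negb_or.
by rewrite -andbA; case: (g == e); case: (g \in l).
Qed.

Lemma plane_foldl_reduce M l : plane M -> plane (foldl (@reduce E) M l).
Proof. by elim: l M => //= e l IHl M pM; apply: IHl; apply: plane_reduce. Qed.

Lemma foldl_reduce_extend M l phi : plane M ->
  preserves (sigma (foldl (@reduce E) M l)) phi ->
  exists2 psi, preserves (sigma M) psi & {in darts (foldl (@reduce E) M l), psi =1 phi}.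
Proof.
elim: l M => [|e l IHl] M /= pM Hphi; first by exists phi.
have [psi Hpsi psiE] := IHl _ (plane_reduce e pM) Hphi.
have [chi Hchi chiE] := reduce_extend pM Hpsi; exists chi => // x xl.
rewrite chiE ?psiE //; move: xl; rewrite /darts edges_foldl_reduce !inE.
by case/andP.
Qed.

Lemma foldl_reduce_unrestrict M F l : plane M -> F \subset edges (foldl (@reduce E) M l) ->
  nonseparable F (sigma (restrict (foldl (@reduce E) M l) F)) ->
  restrict (foldl (@reduce E) M l) F = restrict M F.
Proof.
elim: l M => //= e l IHl M pM Fl ns; have rE := IHl _ (plane_reduce e pM) Fl ns.
rewrite rE; apply: unrestrict_reduce => //; last by rewrite -rE.
by apply: subset_trans Fl _; rewrite edges_foldl_reduce subsetDl.
Qed.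

Lemma deleteE J S : delete J S = restrict J (edges J :\: S). Proof. by []. Qed.

Lemma is_loop_restrict J S e : e \in S -> is_loop (restrict J S) e = is_loop J e.
Proof.
move=> eS; have [to from] : src (restrict J S) (e, false) = src (restrict J S) (e, true)
    <-> src J (e, false) = src J (e, true) by apply: src_restrict; rewrite inE.
exact/eqP/eqP.
Qed.

Lemma foldl_contract_loops K l : uniq l -> {in l, forall e, is_loop K e} ->
  foldl (@contract E) K l = delete K [set e in l].
Proof.
elim: l K => [|e l IHl] K /=.
  move=> _ _; rewrite deleteE (_ : _ :\: _ = edges K) ?restrict_id //.
  by apply/setP => e; rewrite !inE.
move=> /andP[el ul] loops; rewrite /contract loops ?mem_head // IHl // => [|g gl].
  rewrite !deleteE restrict_restrict ?subsetDl //; congr restrict.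
  by apply/setP => g; rewrite !inE negb_or -andbA; case: (g == e); case: (g \in l).
have lg : is_loop K g by apply: loops; rewrite inE gl orbT.
rewrite deleteE is_loop_restrict // !inE (loop_in lg) andbT.
by apply: contraNneq el => <-.
Qed.

(** A cycle contraction, together with the deletion of the loops it creates, is a
    sequence of contractions of single edges, since contracting a loop means
    deleting it.  Seen in the primal, it is a sequence of reductions. *)
Lemma cc_stepE M c (M1 := foldl (@reduce E) M [seq d.1 | d <- c])
    (S := created_loops (dual M) (dual M1)) :
  delete (contract_cycle (dual M) c) (created_loops (dual M) (contract_cycle (dual M) c))
  = dual (foldl (@reduce E) M1 (enum S)).
Proof.
rewrite /contract_cycle foldl_contract_dual -/M1 -/S -foldl_contract_dual.
rewrite foldl_contract_loops ?enum_uniq ?set_enum // => e.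
by rewrite mem_enum inE => /and3P[].
Qed.

Lemma walk_darts J u w v : walk J u w v -> {subset w <= darts J}.
Proof.
elim: w u => //= d w IHw u /and3P[dJ _ /IHw wJ] x.
by rewrite inE => /orP[/eqP ->|/wJ].
Qed.

Lemma walk_transfer J K u v w x y :
  {in darts K &, forall x y, src J x = src J y -> src K x = src K y} ->
  {subset w <= darts K} -> walk J u w v -> x \in darts K -> y \in darts K ->
  src J x = u -> src J y = v -> walk K (src K x) w (src K y).
Proof.
move=> JK; elim: w u x => [|d w IHw] u x wK /=.
  by move=> /eqP -> xK yK xu yv; apply/eqP/JK => //; rewrite xu.
case/and3P=> dJ /eqP du ww xK yK xu yv; have dK : d \in darts K by apply: wK; apply: mem_head.
rewrite dK (JK d x) // ?xu // eqxx /=; apply: (IHw (tgt J d)) => //.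
- by move=> f fw; apply: wK; rewrite inE fw orbT.
- by rewrite mem_rev_dart.
Qed.

(** Contracting the first edge of a cycle leaves a shorter cycle.  In the merged map,
    only the source and the target of a are identified, and a is the only dart of the
    cycle that leaves its source. *)
Lemma contract_cycle_tail K a c : c != [::] -> is_cycle K (a :: c) ->
  ~~ is_loop K a.1 /\ is_cycle (contract K a.1) c.
Proof.
move=> c0 [_ [u wu] us ue]; set e := a.1.
have [aK /eqP au wc] := and3P wu.
have nl : ~~ is_loop K e.
  suff : src K a != tgt K a.
    by rewrite /is_loop /tgt /e; case: (a) => g [] //=; rewrite eq_sym.
  case: c c0 wc us {wu ue} => // f c _ /and3P[_ /eqP <- _].
  by rewrite /= inE negb_or => /andP[/andP[]].
have tE : (sigma K * tperm (e, false) (e, true) = sigma K * tperm a (rev_dart a))%g.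
  by congr (_ * _)%g; rewrite /e; case: (a) => g [] //=; rewrite tpermC.
have ends : porbit (sigma K) a != porbit (sigma K) (rev_dart a).
  by move: nl; rewrite /is_loop /src /e; case: (a) => g [] //=; rewrite eq_sym.
rewrite /contract (negPf nl) tE; split=> //.
set q := (sigma K * _)%g; set K' := induced_map _ q.
have pres phi : preserves q phi <-> preserves (sigma K) phi /\ phi a = phi (rev_dart a).
  exact: merge_preserves.
have q1 x y : src K x = src K y -> porbit q x = porbit q y.
  move=> xy; apply/esym/eqP.
  have /= <- := preserves_porbit (iffLR (pres _) (preserves_mem_porbit q x)).1 xy.
  by rewrite eqxx.
(* The rotation q merges the two ends of a, and only those. *)
have q2 : porbit q a = porbit q (rev_dart a).
  by have /= := (iffLR (pres _) (preserves_mem_porbit q a)).2; rewrite eqxx => /esym/eqP.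
have q3 x y : porbit q x = porbit q y -> src K x != src K a -> src K y != src K a ->
    src K x = src K y.
  move=> xy xa ya; have sp z : preserves (sigma K) [pred y | src K y == z].
    by move=> y' /=; rewrite /src porbit_step.
  have [xr|xr] := eqVneq (src K x) (tgt K a).
    have /(pres _) Hq : preserves (sigma K) [pred y | src K y \in [:: src K a; tgt K a]]
      /\ src K a \in [:: src K a; tgt K a] = (tgt K a \in [:: src K a; tgt K a]).
      by rewrite !inE !eqxx orbT; split=> // y'; rewrite /= /src porbit_step.
    have /= := preserves_porbit Hq xy.
    by rewrite !inE xr eqxx orbT (negPf ya) /= => /esym/eqP.
  have Hq : preserves q [pred y | src K y == src K x].
    apply/pres; split; first exact: sp.
    by rewrite /= eq_sym (negPf xa) eq_sym (negPf xr).
  by have /= := preserves_porbit Hq xy; rewrite eqxx => /esym/eqP.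
have K'q x y : x \in darts K' -> y \in darts K' ->
    src K' x = src K' y <-> porbit q x = porbit q y by apply: porbit_first_return.
have cK' x : x \in c -> x \in darts K'.
  move=> xc; have xK := walk_darts wc xc; move: xK; rewrite !inE => ->; rewrite andbT.
  case/andP: ue => /= /mapP ae _; apply/eqP => xe; apply: ae.
  by exists x.
have ca x : x \in c -> src K x != src K a.
  move=> xc; case/andP: us => /mapP ac _; apply/eqP => xa; apply: ac.
  by exists x.
split=> //.
- case/lastP: c c0 wc cK' {wu us ue ca} => // c f _.
  rewrite -cats1 => /[dup] wcf /walk_cat[z _ /= /and3P[_ _ /eqP fu]] cK'.
  have [g [s cE]] : exists g s, c ++ [:: f] = g :: s.
    by case: (c) => [|g s]; [exists f, [::]|exists g, (s ++ [:: f])].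
  have gK : g \in darts K' by apply: cK'; rewrite cE mem_head.
  have fK : rev_dart f \in darts K'.
    by rewrite mem_rev_dart cK' // mem_cat mem_head orbT.
  have gt : src K g = tgt K a by move: wcf; rewrite cE => /and3P[_ /eqP].
  have fa : src K (rev_dart f) = src K a by rewrite au.
  exists (src K' g).
  have -> : walk K' (src K' g) (c ++ [:: f]) (src K' g)
      = walk K' (src K' g) (c ++ [:: f]) (src K' (rev_dart f)).
    congr walk; apply/(K'q _ _ gK fK).
    by rewrite (q1 g (rev_dart a)) // -q2; apply: q1.
  apply: (walk_transfer _ cK' wcf gK fK gt fu) => x y xK yK /q1 xy.
  exact/(K'q x y).
- move: us => /= /andP[_]; rewrite !uniq_pairwise !pairwise_map.
  apply: (@sub_in_pairwise _ (mem c)); last exact/allP.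
  move=> x y xc yc /=; apply: contraNneq => /(K'q _ _ (cK' x xc) (cK' y yc)) xy.
  by apply/eqP; apply: q3 => //; apply: ca.
by case/andP: ue.
Qed.

(** A cycle of the dual that contains d gives a cut of M that contains d and no edge
    outside the cycle.  When the other edges have been contracted in the dual, d is
    a loop there, hence a bridge; its cut extends to M. *)
Lemma rcons_cycle_cut M c d : plane M -> is_cycle (dual M) (rcons c d) ->
  exists phi, [/\ preserves (sigma M) phi, phi d != phi (rev_dart d)
    & {in darts M, forall x, x.1 \notin [seq f.1 | f <- rcons c d] ->
        phi (rev_dart x) = phi x}].
Proof.
elim: c M => [|a c IHc] M pM.
  case=> _ [u /= /and3P[dM /eqP du /eqP ud]] _ _.
  have l : is_loop (dual M) d.1.
    rewrite /is_loop; have := etrans du (esym ud); rewrite /tgt.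
    by case: (d) => g [] /= ->.
  have [phi [sphi phi0 phi1 rphi]] := dual_loop_bridge pM l.
  exists phi; split=> // [|x _]; last by rewrite inE; apply: rphi.
  by move: phi0 phi1; case: (d) => g [] /= -> /negPf ->.
rewrite rcons_cons => cyc; have := contract_cycle_tail _ cyc.
case=> [|nl]; first by case: (c).
rewrite contract_dual => cyc'; have [phi [sphi phid rphi]] := IHc _ (plane_reduce _ pM) cyc'.
have [psi spsi psiE] := reduce_extend pM sphi; exists psi.
have [_ [u wu] _ ue] := cyc'.
have dM : d \in darts (reduce M a.1).
  by have := walk_darts wu; apply; rewrite mem_rcons mem_head.
split=> // [|x xM]; first by rewrite !psiE ?mem_rev_dart.
rewrite /= inE negb_or => /andP[xa xc].
have xR : x \in darts (reduce M a.1).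
  by move: xM; rewrite /darts edges_reduce !inE => ->; rewrite xa.
by rewrite !psiE ?mem_rev_dart // rphi.
Qed.

Lemma cycle_cut M c e : plane M -> is_cycle (dual M) c -> e \in [seq f.1 | f <- c] ->
  exists phi, [/\ preserves (sigma M) phi, phi (e, false) != phi (e, true)
    & {in darts M, forall x, x.1 \notin [seq f.1 | f <- c] ->
        phi (rev_dart x) = phi x}].
Proof.
move=> pM cyc /mapP[d dc ->].
have [s [t cE]] : exists s t, c = s ++ d :: t.
  by case/splitPr: dc => s t; exists s, t.
have cyc' : is_cycle (dual M) (rcons (t ++ s) d).
  case: cyc => _ [u wu] us ue.
  move: wu; rewrite cE => /walk_cat[v us' /= /and3P[dM dv vt]].
  have pE : perm_eq c (rcons (t ++ s) d).
    by rewrite cE perm_sym perm_rcons -cat_cons perm_catC.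
  split; first by case: (t ++ s).
  - exists (tgt (dual M) d); rewrite -cats1; apply: cat_walk (cat_walk vt us') _.
    by rewrite /= dM dv eqxx.
  - by rewrite -(perm_uniq (perm_map _ pE)).
  - by rewrite -(perm_uniq (perm_map _ pE)).
have [phi [sphi phid rphi]] := rcons_cycle_cut pM cyc'; exists phi; split=> //.
  by move: phid; case: (d) => g [] //=; rewrite eq_sym.
move=> x xM xc; apply: rphi => //; apply: contra xc => /mapP[f].
rewrite mem_rcons inE mem_cat => fc ->; apply: map_f; rewrite cE mem_cat inE.
by case/or3P: fc => ->; rewrite ?orbT.
Qed.

End DualCycles.

(** * From induced submaps to contractions of the dual *)

Section CycleContractions.
Variable E : finType.
Implicit Types (G H J K L M N : rmap E) (d x y a b : dart E) (e : E) (S F : {set E}).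
Implicit Types (p q : {perm dart E}) (phi psi chi : dart E -> bool).
Implicit Types (c s w : seq (dart E)) (l : seq E) (u v : {set dart E}).

Local Notation alpha := (rev_perm E).

(** Each edge outside F belongs to a cut that avoids F: in matroid terms, F is a flat
    of the cycle matroid of M.  For the edge set of a connected subgraph, this says
    that the subgraph is induced, provided that M is loopless. *)
Definition cut_closed M F := forall d, d \in darts M -> d.1 \notin F ->
  exists phi, [/\ preserves (sigma M) phi, phi d != phi (rev_dart d)
    & {in darts_of F, forall x, phi (rev_dart x) = phi x}].

Lemma periodic_point (T : finType) (g : T -> T) (x : T) :
  exists n, fcycle g (fingraph.orbit g (iter n g x)).
Proof.
have /trajectP[i io iE] := looping_order g x.
exists i; apply/(orbitPcycle 3 0); exists (fingraph.order g x - i).-1.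
by rewrite prednK ?subn_gt0 // -iterD subnK // ltnW.
Qed.

(** A nonempty cut that avoids F contains a cycle of the dual.  Orient its edges from
    the first side of the cut to the second.  A dart of the cut leads in the dual to a
    face whose boundary crosses the cut back again, at another dart of the cut;
    following such darts, one runs into a cycle. *)
Lemma dual_cycle_avoiding M F : F \subset edges M -> F != edges M -> cut_closed M F ->
  exists2 c, is_cycle (dual M) c & {in c, forall d, d.1 \notin F}.
Proof.
move=> FM FnM closed; have Sf := stable_facial (@stable_sigma _ M).
set f := facial (sigma M) in Sf.
have [e eM eF] : exists2 e, e \in edges M & e \notin F.
  by move: FnM; rewrite eqEsubset FM => /subsetPn.
have e0M : (e, false) \in darts M by rewrite inE.
have [phi [sphi phie rphi]] := closed _ e0M eF.
(* The darts that cross the cut from the side of colour true. *)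
pose A := [set x in darts M | phi x && ~~ phi (rev_dart x)].
have [d dA] : exists d, d \in A.
  case phi0 : (phi (e, false)) phie => phi1; [exists (e, false)|exists (e, true)].
    by rewrite !inE /= eM phi0.
  rewrite !inE /= eM -[(e, true)]/(rev_dart (e, false)); move: phi1.
  by case: (phi (rev_dart _)) => //; rewrite rev_dartK phi0.
have fphi x : phi (f x) = phi (rev_dart x).
  by rewrite /f facialE (preservesV sphi).
pose next_pred x := [pred y in A | porbit f y == porbit f (rev_dart x)].
(* nxt x depends only on the face that x leads to, so that different darts in the
   image of nxt leave different faces. *)
pose nxt x := odflt x [pick y | next_pred x y].
have nxtP x : x \in A -> nxt x \in A /\ porbit f (nxt x) = porbit f (rev_dart x).
  rewrite inE => /and3P[xM px nrx].
  rewrite /nxt; case: pickP => [y /andP[yA /eqP yx]|no] //=.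
  have frx : phi (f (rev_dart x)) != phi (rev_dart x).
    by rewrite fphi rev_dartK px; case: (phi _) nrx.
  have [y [yx yphi fy]] := opposite_change frx.
  have /negP[] := no y; rewrite /= yx eqxx andbT inE -fphi fy nrx yphi fphi rev_dartK px !andbT.
  by rewrite /darts (stable_porbit Sf yx) mem_rev_dart.
have [n cyc] := periodic_point nxt d; set y := iter n nxt d in cyc.
set c := fingraph.orbit nxt y in cyc.
have yA : y \in A by rewrite /y; elim: (n) => //= k /nxtP[].
have cA : {in c, forall x, x \in A}.
  move=> x; rewrite -fconnect_orbit => /iter_findex <-.
  by elim: findex => //= k /nxtP[].
have AM x : x \in A -> x \in darts M by rewrite inE => /andP[].
have src_inj : {in c &, injective (src (dual M))}.
  move=> x x' xc x'c /(src_dual (AM _ (cA _ xc)) (AM _ (cA _ x'c))) xx'.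
  have /eqP xE := prev_cycle cyc xc; have /eqP x'E := prev_cycle cyc x'c.
  have /cA/nxtP[x1A x1f] : prev c x \in c by rewrite mem_prev.
  have /cA/nxtP[x2A x2f] : prev c x' \in c by rewrite mem_prev.
  rewrite xE in x1f; rewrite x'E in x2A x2f; rewrite -xE -x'E /nxt.
  have -> : [pick z | next_pred (prev c x) z] = [pick z | next_pred (prev c x') z].
    by apply: eq_pick => z; rewrite /= -x1f -x2f xx'.
  by case: pickP => // /(_ x'); rewrite /= x2A x2f eqxx.
exists c.
  split.
  - by rewrite /c /fingraph.orbit -orderSpred.
  - have tgtE x : x \in A -> tgt (dual M) x = src (dual M) (nxt x).
      move=> xA; have [nA nf] := nxtP _ xA.
      by apply/src_dual; rewrite ?mem_rev_dart ?AM.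
    have walkA s x z : path (frel nxt) x (rcons s z) -> {subset x :: s <= A} ->
        walk (dual M) (src (dual M) x) (x :: s) (src (dual M) z).
      elim: s x => [|x' s IHs] x /andP[/eqP xE xs] sA.
        have xA : x \in A by apply: sA; apply: mem_head.
        by apply/and3P; rewrite tgtE // xE eqxx; split=> //; apply: AM.
      have xA : x \in A by apply: sA; apply: mem_head.
      apply/and3P; split; [exact: AM|exact: eqxx|].
      by rewrite tgtE // xE; apply: IHs => // z' z's; apply: sA; rewrite inE z's orbT.
    have cE : c = y :: behead c by rewrite /c /fingraph.orbit -orderSpred.
    exists (src (dual M) y); rewrite cE; apply: walkA; first by move: cyc; rewrite cE.
    by rewrite -cE.
  - by rewrite map_inj_in_uniq ?orbit_uniq.
  rewrite map_inj_in_uniq ?orbit_uniq // => x x' /cA xA /cA x'A /same_edge[//|xE].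
  by move: xA x'A; rewrite !inE xE rev_dartK => /and3P[_ -> _] /and3P[].
move=> x /cA; rewrite inE => /and3P[_ px nrx]; apply: contra nrx => xF.
by rewrite rphi // inE.
Qed.

(** When a bridge is contracted, a cut that contains it is replaced by its symmetric
    difference with the cut formed by the bridge. *)
Lemma cut_closed_reduce M F e : plane M -> e \notin F -> cut_closed M F ->
  cut_closed (reduce M e) F.
Proof.
move=> pM eF closed d; rewrite /darts edges_reduce inE => /setD1P[de dM] dF.
have [phi [sphi phid rphi]] := closed d ltac:(by rewrite inE) dF.
rewrite /reduce; case: ifP => l.
  have [psi psiP] := dual_loop_bridge pM l; have [spsi psi0 psi1 rpsi] := psiP.
  have ends := bridge_ends psiP.
  (* The symmetric difference of the two cuts, if phi separates the ends of e. *)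
  pose chi x := if phi (e, false) == phi (e, true) then phi x else phi x (+) psi x.
  exists chi; split.
  - apply: first_return_preserves; apply/(merge_preserves _ ends); rewrite /chi; split.
      by move=> x; rewrite sphi spsi.
    case: eqVneq => //; rewrite psi0 (negPf psi1).
    by case: (phi _) (phi _) => [] [].
  - rewrite /chi rpsi //; case: ifP => // _.
    by apply: contraNneq phid => /addIb ->.
  move=> x xF; rewrite /chi rphi // rpsi //.
  by apply: contraNneq eF => <-; rewrite inE in xF.
by exists phi; split=> //; apply: first_return_preserves.
Qed.

Lemma foldl_reduce_closed M F l : plane M -> F \subset edges M ->
  nonseparable F (sigma (restrict M F)) -> cut_closed M F -> {in l, forall e, e \notin F} ->
  [/\ plane (foldl (@reduce E) M l), F \subset edges (foldl (@reduce E) M l),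
      restrict (foldl (@reduce E) M l) F = restrict M F
    & cut_closed (foldl (@reduce E) M l) F].
Proof.
elim: l M => //= e l IHl M pM FM ns closed lF.
have eF : e \notin F by apply: lF; apply: mem_head.
have rE := restrict_reduce pM FM eF ns.
have FM' : F \subset edges (reduce M e) by rewrite edges_reduce subsetD1 FM.
rewrite -rE; apply: (IHl _ (plane_reduce e pM) FM').
- by have := congr1 (@sigma E) rE => /= ->.
- exact: cut_closed_reduce.
by move=> g gl; apply: lF; rewrite inE gl orbT.
Qed.

Lemma cc_minor_front J K L : cc_minor L K -> cc_step J K -> cc_minor L J.
Proof.
move=> LK JK; elim: LK JK => [K' JK|K1 L1 K' _ IH KL JK].
  exact: cc_minor_step (cc_minor_refl J) JK.
exact: cc_minor_step (IH JK) KL.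
Qed.

(** As long as there are edges outside F, the dual has a cycle that avoids F.  After
    its contraction, no loop belongs to F, because a loop of the dual is a bridge and F
    is bridgeless; so the contraction and the deletion of loops keep the part F and
    its properties, with fewer edges in total. *)
Lemma cc_minor_restrict M F : plane M -> F \subset edges M -> 1 < #|F| ->
  nonseparable F (sigma (restrict M F)) -> cut_closed M F ->
  plane (restrict M F) /\ cc_minor (dual (restrict M F)) (dual M).
Proof.
move=> + + F2; have [n] := ubnP #|edges M|; elim: n M => // n IHn M Mn pM FM ns closed.
have [FE|FnM] := eqVneq F (edges M).
  by rewrite FE restrict_id; split=> //; apply: cc_minor_refl.
have [c cyc cF] := dual_cycle_avoiding FM FnM closed.
pose M1 := foldl (@reduce E) M [seq d.1 | d <- c].
pose S := created_loops (dual M) (dual M1); pose M' := foldl (@reduce E) M1 (enum S).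
have step : cc_step (dual M) (dual M') by exists c; rewrite ?cc_stepE.
have [pM1 FM1 M1F closed1] : [/\ plane M1, F \subset edges M1,
    restrict M1 F = restrict M F & cut_closed M1 F].
  by apply: foldl_reduce_closed => // _ /mapP[d /cF dF ->].
have ns1 : nonseparable F (sigma (restrict M1 F)) by rewrite M1F.
have [pM' FM' M'F closed'] : [/\ plane M', F \subset edges M',
    restrict M' F = restrict M1 F & cut_closed M' F].
  apply: foldl_reduce_closed => // e; rewrite mem_enum inE => /and3P[_ l _].
  have [phi [sphi phi0 phi1 rphi]] := dual_loop_bridge pM1 l.
  apply: contraNN phi1 => eF.
  rewrite -(nonseparable_bridgeless _ ns1 F2 (d := (e, false)) (phi := phi)) //.
  - exact: stable_sigma.
  - by rewrite inE.
  - exact: first_return_preserves.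
  by move=> x _; apply: rphi.
rewrite -M1F -M'F.
have cardM' : #|edges M'| < #|edges M|.
  apply: proper_card; rewrite properE; apply/andP; split.
    by rewrite !edges_foldl_reduce; do 2 apply: subset_trans (subsetDl _ _) _.
  have [d dc] : exists d, d \in c by case: cyc; case: (c) => // d s _ _ _ _; exists d; apply: mem_head.
  case: cyc => _ [u /walk_darts wu] _ _.
  apply/subsetPn; exists d.1; first by have := wu d dc; rewrite inE.
  by rewrite !edges_foldl_reduce !inE map_f //= andbF.
have ns' : nonseparable F (sigma (restrict M' F)) by rewrite M'F.
have [pr cc] := IHn M' (leq_trans cardM' Mn) pM' FM' ns' closed'.
by split=> //; apply: cc_minor_front cc step.
Qed.

End CycleContractions.

(** * From contractions of the dual to induced submaps *)

Section CutMinors.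
Variable E : finType.
Implicit Types (G H J K L M N : rmap E) (d x y a b : dart E) (e : E) (S F : {set E}).
Implicit Types (p q : {perm dart E}) (phi psi chi : dart E -> bool).
Implicit Types (c s w : seq (dart E)) (l : seq E) (u v : {set dart E}).

Local Notation alpha := (rev_perm E).

(** The properties of the primal M of a cc-minor of the dual of G that are carried
    along a sequence of cycle contractions: cuts of M extend to cuts of G, the
    removed edges are covered by cuts that consist of removed edges, and nonseparable
    parts of M are parts of G. *)
Definition cut_minor M G :=
  [/\ plane M, edges M \subset edges G,
      forall phi, preserves (sigma M) phi ->
        exists2 psi, preserves (sigma G) psi & {in darts M, psi =1 phi},
      cut_closed G (edges M)
    & forall F, F \subset edges M -> nonseparable F (sigma (restrict M F)) ->
        restrict M F = restrict G F].

Lemma cut_minor_refl G : plane G -> cut_minor G G.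
Proof.
move=> pG; split=> // [phi sphi|d dG /negP[]]; first by exists phi.
by rewrite inE in dG.
Qed.

(** An edge of the contracted cycle is in a cut contained in the cycle, a created loop
    is a bridge at the moment it is deleted; both cuts avoid the remaining edges and
    extend to G. *)
Lemma cut_minor_step G M K : cut_minor M G -> cc_step (dual M) K ->
  exists2 M', K = dual M' & cut_minor M' G.
Proof.
case=> pM MG ext closed restr [c cyc ->]; rewrite cc_stepE.
pose M1 := foldl (@reduce E) M [seq d.1 | d <- c].
pose S := created_loops (dual M) (dual M1); pose M' := foldl (@reduce E) M1 (enum S).
exists M' => //.
have pM1 : plane M1 by apply: plane_foldl_reduce.
have M1M : edges M1 \subset edges M by rewrite edges_foldl_reduce subsetDl.
have M'M1 : edges M' \subset edges M1 by rewrite edges_foldl_reduce subsetDl.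
have M'M := subset_trans M'M1 M1M.
have dartsS (A B : {set E}) : A \subset B -> {subset darts_of A <= darts_of B}.
  by move=> AB x; rewrite !inE; apply: (subsetP AB).
split.
- exact: plane_foldl_reduce.
- exact: subset_trans MG.
- move=> phi /(foldl_reduce_extend pM1)[phi1 /(foldl_reduce_extend pM)[phi2 sphi2 E2] E1].
  have [psi spsi E3] := ext _ sphi2; exists psi => // x xM'.
  have xM1 := dartsS _ _ M'M1 x xM'.
  by rewrite E3 ?E2 ?E1 //; apply: (dartsS _ _ M1M).
- move=> d dG dM'; have [dM|dM] := boolP (d.1 \in edges M); last first.
    have [phi [sphi phid rphi]] := closed d dG dM; exists phi; split=> // x xM'.
    by apply: rphi; apply: dartsS xM'.
  suff [phi [sphi phid rphi]] : exists phi, [/\ preserves (sigma M) phi,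
      phi (d.1, false) != phi (d.1, true)
      & {in darts_of (edges M'), forall x, phi (rev_dart x) = phi x}].
    have [psi spsi psiE] := ext _ sphi; exists psi; split=> //.
      rewrite !psiE ?inE //; move: phid; case: (d) => g [] //=.
      by rewrite eq_sym.
    by move=> x xM'; have xM := dartsS _ _ M'M x xM'; rewrite !psiE ?mem_rev_dart // rphi.
  have [dc|dc] := boolP (d.1 \in [seq f.1 | f <- c]).
    have [phi [sphi phid rphi]] := cycle_cut pM cyc dc; exists phi; split=> // x xM'.
    apply: rphi; first exact: dartsS xM'.
    have := dartsS _ _ M'M1 x xM'; rewrite inE edges_foldl_reduce !inE.
    by case/andP.
  have dM1 : d.1 \in edges M1 by rewrite edges_foldl_reduce !inE dc.
  have dS : d.1 \in S.
    by move: dM'; rewrite edges_foldl_reduce in_setD dM1 andbT negbK in_set mem_enum.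
  have l : is_loop (dual M1) d.1 by move: dS; rewrite inE => /and3P[].
  have [phi [sphi phi0 phi1 rphi]] := dual_loop_bridge pM1 l.
  have [psi spsi psiE] := foldl_reduce_extend pM sphi; exists psi; split=> //.
    by rewrite !psiE ?inE // phi0; case: (phi _) phi1.
  move=> x xM'; have xM1 := dartsS _ _ M'M1 x xM'.
  rewrite !psiE ?mem_rev_dart //; apply: rphi.
  by apply: contraNneq dM' => <-; rewrite inE in xM'.
move=> F FM' ns; have E1 := foldl_reduce_unrestrict pM1 FM' ns.
have FM1 := subset_trans FM' M'M1.
rewrite E1 in ns; have E2 := foldl_reduce_unrestrict pM FM1 ns.
by rewrite E1 E2 restr // -?E2 //; apply: subset_trans FM1 M1M.
Qed.

Lemma cc_minor_cut_minor G K : plane G -> cc_minor K (dual G) ->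
  exists2 M, K = dual M & cut_minor M G.
Proof.
move=> pG; move JE : (dual G) => J KJ; elim: KJ JE => [J' <-|K' L J' _ IH KL JE].
  by exists G => //; apply: cut_minor_refl.
by have [M KE MG] := IH JE; rewrite KE in KL; apply: cut_minor_step MG KL.
Qed.

Lemma cc_step_loopless J K : loopless J -> cc_step J K -> loopless K.
Proof.
move=> ll [c cyc ->] e; set J1 := contract_cycle J c.
move=> eK; have eD : e \in edges J1 :\: created_loops J J1 by [].
rewrite is_loop_restrict //; move: eD; rewrite !inE negb_and => /andP[eN eJ1].
rewrite eJ1 /= negb_and negbK in eN; case/orP: eN => // l.
have eJ : e \in edges J by apply: loop_in.
by have := ll e eJ; rewrite l.
Qed.

Lemma cc_minor_loopless J K : loopless J -> cc_minor K J -> loopless K.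
Proof.
move=> + KJ; elim: KJ => // K' L J' _ IH KL /IH ll.
exact: cc_step_loopless KL.
Qed.

Lemma nonseparable_dual J : plane J -> nonseparable (edges J) (sigma J) ->
  nonseparable (edges (dual J)) (sigma (dual J)).
Proof.
move=> /plane_spherical sph ns.
apply: (nonseparable_eq (p := facial (sigma J))).
- exact: stable_facial (@stable_sigma _ J).
- exact: stable_sigma.
- by move=> x xJ; rewrite sigma_dual.
exact: dual_nonseparable (@stable_sigma _ J) sph ns.
Qed.

(** The double dual is the map conjugated by the edge involution, which preserves the
    edge colourings. *)
Lemma nonseparable_dual_inv J : plane J ->
  nonseparable (edges (dual J)) (sigma (dual J)) -> nonseparable (edges J) (sigma J).
Proof.
move=> /plane_spherical sph ns; have Sf := stable_facial (@stable_sigma _ J).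
have nsf : nonseparable (edges J) (facial (sigma J)).
  by apply: nonseparable_eq ns => // [|x xJ]; [exact: stable_sigma|rewrite sigma_dual].
have := dual_nonseparable Sf (spherical_dual (rev_perm2 E) sph) nsf.
move=> nsff chi a b rchi aJ bJ ca cb.
have chirev x : chi (rev_dart x) = chi x by rewrite -rev_permE rchi.
have [x [y [xJ yJ cx cy xy]]] := nsff chi a b rchi aJ bJ ca cb.
exists (rev_dart x), (rev_dart y); rewrite !mem_rev_dart !chirev.
rewrite !facial2 !chirev in cx cy; split=> //.
apply: contraNneq xy => /same_porbit[n xyn].
rewrite -[y]rev_dartK xyn; elim: (n) => [|k IHk]; first by rewrite rev_dartK.
rewrite (eqP IHk) -(porbit_step _ (rev_dart (iter k _ _))) facial2 rev_dartK.
exact: eqxx.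
Qed.

End CutMinors.

Theorem lemma1p2 (E : finType) (G H : rmap E) :
  plane G -> loopless G -> two_connected G ->
  (two_connected H /\ induced_subgraph H G) <->
  (two_connected (dual H) /\ cc_minor (dual H) (dual G)).
Proof.
move=> pG llG tG; have nsG := two_connected_nonseparable llG tG.
have G2 := two_connected_edges llG tG; split.
  case=> tH [X XG HE]; set F := [set e in edges G | (src G (e, false) \in X)
                                                  && (src G (e, true) \in X)] in HE.
  have {}HE : H = restrict G F := HE.
  have FG : F \subset edges G by apply/subsetP => e /setIdP[].
  have llH : loopless H.
    by rewrite HE => e eF; rewrite is_loop_restrict // llG // (subsetP FG).
  have nsH := two_connected_nonseparable llH tH.
  have H2 := two_connected_edges llH tH.
  (* An edge outside F is cut by X if it has one end in X, and by either of its
     ends if it has none there. *)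
  have closed : cut_closed G F.
    have FX x : x \in darts_of F -> src G x \in X.
      by case: x => g []; rewrite !inE => /and3P[_ X0 X1].
    move=> d dG dF; case: (boolP ((src G d \in X) == (src G (rev_dart d) \in X))) => sX; last first.
      exists (fun x => src G x \in X); split=> // [x|x xF]; first by rewrite /src porbit_step.
      by rewrite !FX ?mem_rev_dart.
    have dX : src G d \notin X.
      apply: contra dF => dX; rewrite dX eq_sym eqb_id in sX.
      have dE : d.1 \in edges G by rewrite inE in dG.
      by move: dX sX; rewrite !inE dE; case: (d) => g [] /= -> ->.
    exists (fun x => src G x == src G d); split=> [x||x xF].
    - by rewrite /src porbit_step.
    - by rewrite eqxx eq_sym eqb_id eq_sym nonloop.
    have nX y : y \in darts_of F -> (src G y == src G d) = false.
      by move=> /FX yX; apply: contraNF dX => /eqP <-.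
    by rewrite !nX ?mem_rev_dart.
  have [pH cc] : plane (restrict G F) /\ cc_minor (dual (restrict G F)) (dual G).
    by apply: cc_minor_restrict => //; rewrite HE in nsH H2.
  rewrite -HE in pH cc; split=> //.
  exact: nonseparable_two_connected (nonseparable_dual pH nsH) H2.
case=> tD cc; have [M dME [pM MG ext closed restr]] := cc_minor_cut_minor pG cc.
move: (dual_inj dME) => {dME} ME; subst M.
have llD : loopless (dual H).
  apply: cc_minor_loopless cc.
  by apply: (@nonseparable_loopless _ (dual G)) G2; apply: nonseparable_dual.
have nsH := nonseparable_dual_inv pM (two_connected_nonseparable llD tD).
have H2 : 1 < #|edges H| := two_connected_edges llD tD.
split; first exact: nonseparable_two_connected.
have HE : H = restrict G (edges H) by rewrite -restr ?restrict_id.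
(* An edge between vertices of H that is not in H would be in a cut avoiding H, and
   H, being connected, would be on both sides of it. *)
exists [set src G d | d in darts_of (edges H)].
  apply/subsetP => _ /imsetP[d dH ->]; apply: imset_f.
  by move: dH; rewrite !inE; apply: (subsetP MG).
rewrite /induced_sub -/(restrict _ _) {1}HE; congr restrict; apply/setP => e.
rewrite inE; apply/idP/and3P => [eH|[eG]].
  split; first exact: (subsetP MG).
    by apply: imset_f; rewrite inE.
  by apply: imset_f; rewrite inE.
move=> /imsetP[x xH xe] /imsetP[y yH ye]; apply: contraT => eH.
have [|phi [sphi phie rphi]] := closed (e, false) _ eH; first by rewrite inE.
rewrite HE in nsH; have /negP[] := phie; apply/eqP.
rewrite (preserves_porbit sphi xe) [phi (rev_dart _)](preserves_porbit sphi ye).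
exact: nonseparable_constant nsH sphi rphi xH yH.
Qed.
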